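(* Let $k$ be a positive integer. The (non-compact) total space $M$ of the holomorphic line bundle $\mathcal{O}(-k)\to\mathbb{P}^1$ carries a complete Kähler metric of semi-positive holomorphic sectional curvature with $r^+_M=1$.
   Context: $\mathbb{P}^1$ is the complex projective line and $\mathcal{O}(-k)$ is the $k$-th power of the tautological line bundle $\mathcal O(-1)$ (the dual of the hyperplane bundle). Let $(M,g)$ be a Hermitian manifold of complex dimension $n$, with $g=\sum g_{i\bar j}\,dz_i\otimes d\bar z_j$ in local holomorphic coordinates. The curvature tensor of the Hermitian (Chern) connection has components $$R_{i\bar j k\bar l}=-\frac{\partial^2 g_{i\bar j}}{\partial z_k\partial\bar z_l}+\sum_{p,q} g^{p\bar q}\frac{\partial g_{i\bar p}}{\partial z_k}\frac{\partial g_{q\bar j}}{\partial \bar z_l}.$$ The holomorphic sectional curvature of a non-zero tangent vector $\xi=\sum_i\xi_i\frac{\partial}{\partial z_i}\in T_pM$ (holomorphic tangent space) is $$H(\xi)=\Big(\sum R_{i\bar jk\bar l}(p)\,\xi_i\bar\xi_j\xi_k\bar\xi_l\Big)\Big/\Big(\sum g_{i\bar j}g_{k\bar l}\,\xi_i\bar\xi_j\xi_k\bar\xi_l\Big).$$ It is semi-positive if $H(\xi)\ge 0$ for all non-zero tangent vectors $\xi$ at all points. Rank invariant: let $M$ be a Hermitian manifold with semi-positive holomorphic sectional curvature $H$ and $n=\dim M$. For $p\in M$, let $\eta(p)$ be the maximum of those integers $k\in\{0,\ldots,n\}$ such that there exists a $k$-dimensional complex subspace $L\subset T_pM$ with $H(v)=0$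 for all $v\in L\setminus\{0\}$. Set $\eta_M:=\min_{p\in M}\eta(p)$ and $r^+_M:=n-\eta_M$. *)

(* Defs.v *)
From HB Require Import structures.
From mathcomp Require Import all_boot all_order all_algebra.
From mathcomp Require Import complex.
From mathcomp Require Import all_classical all_reals all_analysis.

Set Implicit Arguments.
Unset Strict Implicit.
Unset Printing Implicit Defensive.

Import Order.TTheory GRing.Theory Num.Theory.
Import numFieldNormedType.Exports.

Local Open Scope classical_set_scope.
Local Open Scope ring_scope.

(** * Complex manifolds *)

Section ChartTransition.
Variables (K : numFieldType) (n : nat) (T I : Type).
Variable param : I -> 'rV[K]_n -> T.

(* The value at [x] is only meaningful when [param i x] lies in chart [j]. *)
Definition chart_trans (i j : I) (x : 'rV[K]_n) : 'rV[K]_n :=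
  xget 0 [set y | param j y = param i x].

End ChartTransition.

(* Complex manifolds with a finite holomorphic atlas all of whose charts have
   image K^n; a chart is given by its inverse, the parametrization [param i].
   With K = R[i], [differentiable] is complex differentiability. *)
Record cmanifold (K : numFieldType) (n : nat) := CManifold {
  carrier :> topologicalType;
  chart : finType;
  param : chart -> 'rV[K]_n -> carrier;
  param_cover : forall p, exists i x, param i x = p;
  param_inj : forall i, injective (param i);
  param_continuous : forall i, continuous (param i);
  param_open : forall i (U : set 'rV[K]_n), open U -> open (param i @` U);
  carrier_hausdorff : hausdorff_space carrier;
  trans_differentiable : forall i j x y, param i x = param j y ->
    differentiable (chart_trans param i j) x }.
Arguments param {K n} _ _ _.

(** * The total space of O(-k) over the projective line *)

Section TotalSpace.
Variables (K : numFieldType) (k : nat).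

(* k-fold tensor power of K^2, in coordinates *)
Definition tensor := {ffun {ffun 'I_k -> 'I_2} -> K}.

Definition tensor_pow (c : K) (v : 'rV[K]_2) : tensor :=
  [ffun s : {ffun 'I_k -> 'I_2} => c * \prod_(a < k) v 0 (s a)].

(* A point of O(-k) is a line l in K^2, i.e. a point of the projective line,
   together with an element of the k-th tensor power of l (the fibre of O(-1)
   at l being l itself). *)
Definition in_Ominus (q : {vspace 'rV[K]_2} * tensor) : Prop :=
  exists v c, [/\ v != 0, q.1 = <[v]>%VS & q.2 = tensor_pow c v].

Definition Ominus_space := {q : {vspace 'rV[K]_2} * tensor | `[< in_Ominus q >]}.
HB.instance Definition _ := Choice.on Ominus_space.

(* Chart 0 has homogeneous coordinates [1 : z] on the base, chart 1 has
   [z : 1]. *)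
Definition frame (i : 'I_2) (z : K) : 'rV[K]_2 :=
  \row_j (if j == i then 1 else z).

Lemma frame_neq0 i z : frame i z != 0.
Proof.
apply/eqP => /rowP /(_ i); rewrite !mxE eqxx => /eqP.
by rewrite oner_eq0.
Qed.

Lemma in_OminusP (i : 'I_2) (z u : K) :
  `[< in_Ominus (<[frame i z]>%VS, tensor_pow u (frame i z)) >].
Proof. by apply/asboolP; exists (frame i z), u; split => //; apply: frame_neq0. Qed.

(* Coordinates (z, u): base point [frame i z] and fibre coordinate u with
   respect to the local frame [frame i z] ^ (tensor k). *)
Definition Ominus_param (i : 'I_2) (x : 'rV[K]_2) : Ominus_space :=
  exist (fun q => is_true `[< in_Ominus q >]) _ (in_OminusP i (x 0 0) (x 0 1)).

(* The topology for which a set is open iff its traces in both charts are. *)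
Definition Ominus_op (U : set Ominus_space) : Prop :=
  forall i, open (Ominus_param i @^-1` U).

Lemma Ominus_opT : Ominus_op setT.
Proof. by move=> i; rewrite preimage_setT; apply: openT. Qed.

Lemma Ominus_opI : setI_closed Ominus_op.
Proof. by move=> A B oA oB i; rewrite preimage_setI; apply: openI. Qed.

Lemma Ominus_op_bigU (I : Type) (f : I -> set Ominus_space) :
  (forall i, Ominus_op (f i)) -> Ominus_op (\bigcup_i f i).
Proof.
by move=> of_ i; rewrite preimage_bigcup; apply: bigcup_open => j _; apply: of_.
Qed.

HB.instance Definition _ := isOpenTopological.Build Ominus_space
  Ominus_opT Ominus_opI Ominus_op_bigU.

Lemma Ominus_openE (U : set Ominus_space) :
  open U = forall i, open (Ominus_param i @^-1` U).
Proof. by []. Qed.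

Lemma Ominus_sval_inj (p q : Ominus_space) : sval p = sval q -> p = q.
Proof. by move: p q => [p hp] [q hq] /= pq; apply: eq_exist. Qed.

Lemma Ominus_paramE i x j y : Ominus_param i x = Ominus_param j y <->
  <[frame i (x 0 0)%R]>%VS = <[frame j (y 0 0)%R]>%VS /\
  tensor_pow (x 0 1) (frame i (x 0 0)) = tensor_pow (y 0 1) (frame j (y 0 0)).
Proof.
split=> [pq|[h1 h2]].
  by split; [exact: (congr1 (fun p : Ominus_space => (sval p).1) pq)
            |exact: (congr1 (fun p : Ominus_space => (sval p).2) pq)].
by apply: Ominus_sval_inj; rewrite /= h1 h2.
Qed.

Lemma frame_id i z : frame i z 0 i = 1.
Proof. by rewrite mxE eqxx. Qed.

Lemma frame_neq i j z : j != i -> frame i z 0 j = z.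
Proof. by rewrite mxE => /negPf ->. Qed.

Lemma tensor_powZ (c a : K) v :
  tensor_pow c (a *: v) = tensor_pow (c * a ^+ k) v.
Proof.
apply/ffunP => s; rewrite !ffunE -mulrA; congr (_ * _).
under eq_bigr do rewrite mxE.
by rewrite big_split /= prodr_const card_ord.
Qed.

Lemma tensor_pow_inj v : v != 0 -> injective (tensor_pow ^~ v).
Proof.
move=> v0 c d /ffunP cd; have [i vi0] : exists i, v 0 i != 0.
  apply: contra_notP (elimN eqP v0) => /forallNP h; apply/rowP => i.
  by rewrite mxE; apply/eqP; rewrite -[_ == _]negbK; apply/negP/h.
have := cd [ffun => i]; rewrite !ffunE.
under eq_bigr do rewrite ffunE; rewrite prodr_const.
by apply: mulIf; rewrite expf_eq0 negb_and vi0 orbT.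
Qed.

Lemma Ominus_param_inj i : injective (Ominus_param i).
Proof.
move=> x y /Ominus_paramE[/eqP hl ht].
have [a ha] : exists a, frame i (x 0 0) = a *: frame i (y 0 0).
  by apply/vlineP; rewrite -(eqP hl) memv_line.
have a1 : a = 1.
  by move/rowP/(_ i): ha; rewrite !mxE eqxx mulr1.
move: ha; rewrite a1 scale1r => ha.
have xy0 : x 0 0 = y 0 0.
  have [j ji] : exists j : 'I_2, j != i.
    by case: i {hl ht ha} => -[|[|//]] ?; [exists 1|exists 0].
  by move/rowP/(_ j): ha; rewrite !frame_neq.
rewrite xy0 in ht; have xy1 := tensor_pow_inj (frame_neq0 _ _) ht.
apply/rowP => -[[|[|//]] h].
- by have -> : Ordinal h = 0 by exact: val_inj.
- by have -> : Ordinal h = 1 by exact: val_inj.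
Qed.

(* The transition function of O(-k) is z ^ k. *)
Lemma Ominus_transE i j x y : i != j ->
  Ominus_param i x = Ominus_param j y <->
  x 0 0 * y 0 0 = 1 /\ y 0 1 = x 0 0 ^+ k * x 0 1.
Proof.
move=> ij; have ji : j != i by rewrite eq_sym.
have frE a b : a * b = 1 -> frame i a = a *: frame j b.
  move=> ab; apply/rowP => l; rewrite !mxE.
  have [->|li] := eqVneq l i; first by rewrite (negPf ij) ab.
  suff -> : l = j by rewrite eqxx mulr1.
  move: i j l li ij {ji} => [[|[|//]] ?] [[|[|//]] ?] [[|[|//]] ?] // _ _;
    exact: val_inj.
rewrite Ominus_paramE; split=> [[hl ht]|[xy1 y1]].
  have [a ha] : exists a, frame i (x 0 0) = a *: frame j (y 0 0).
    by apply/vlineP; rewrite -hl memv_line.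
  have := congr1 (fun v : 'rV_2 => v 0 i) ha.
  have := congr1 (fun v : 'rV_2 => v 0 j) ha.
  rewrite !mxE !eqxx (negPf ij) (negPf ji) mulr1 => xa.
  rewrite -xa => xy1; split => //.
  move: ht; rewrite ha tensor_powZ => /(tensor_pow_inj (frame_neq0 _ _)) <-.
  by rewrite -xa mulrC.
have x0 : x 0 0 != 0.
  by apply: contra_eq_neq xy1 => ->; rewrite mul0r eq_sym oner_eq0.
rewrite (frE _ _ xy1) tensor_powZ y1 mulrC; split => //.
apply: subv_anti; rewrite -!memvE memvZ ?memv_line//=.
by rewrite -[X in X \in _](scalerK x0) memvZ ?memv_line.
Qed.

Lemma Ominus_param_cover p : exists i x, Ominus_param i x = p.
Proof.
case: p => -[l t] lt; have /asboolP[v [c [/= v0 lv tv]]] := lt.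
have [i vi0] : exists i, v 0 i != 0.
  apply: contra_notP (elimN eqP v0) => /forallNP h; apply/rowP => i.
  by rewrite mxE; apply/eqP; rewrite -[_ == _]negbK; apply/negP/h.
have [j ji] : exists j : 'I_2, j != i.
  by case: i {vi0} => -[|[|//]] ?; [exists 1|exists 0].
exists i, (\row_l if l == 0 then v 0 j / v 0 i else c * v 0 i ^+ k).
have vE : v = v 0 i *: frame i (v 0 j / v 0 i).
  apply/rowP => a; rewrite !mxE; have [->|ai] := eqVneq a i.
    by rewrite mulr1.
  rewrite mulrC divfK//; congr (v _ _).
  move: i j a ji ai {vi0} => [[|[|//]] ?] [[|[|//]] ?] [[|[|//]] ?] // _ _;
    exact: val_inj.
apply: Ominus_sval_inj; rewrite /= !mxE /= lv tv.
rewrite [in RHS]vE tensor_powZ; congr (_, _).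
apply: subv_anti; rewrite -!memvE memvZ ?memv_line//= andbT.
by rewrite -[X in X \in _](scalerK vi0) memvZ ?memv_line.
Qed.

Definition Ominus_chart_change (x : 'rV[K]_2) : 'rV[K]_2 :=
  \row_l (if l == 0 then (x 0 0)^-1 else x 0 0 ^+ k * x 0 1).

Lemma Ominus_chart_changeP i j x y : i != j ->
  Ominus_param i x = Ominus_param j y <->
  x 0 0 != 0 /\ y = Ominus_chart_change x.
Proof.
move=> ij; rewrite (Ominus_transE _ _ ij); split => [[xy1 y1]|[x0 ->]].
  have x0 : x 0 0 != 0.
    by apply: contra_eq_neq xy1 => ->; rewrite mul0r eq_sym oner_eq0.
  split => //; apply/rowP => -[[|[|//]] h]; rewrite mxE.
  - have -> : Ordinal h = 0 by exact: val_inj.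
    by apply: (mulfI x0); rewrite xy1 divff.
  - by have -> : Ordinal h = 1 by exact: val_inj.
by rewrite !mxE /= divff.
Qed.

Lemma Ominus_param_continuous i : continuous (Ominus_param i).
Proof. by apply/continuousP => U; rewrite Ominus_openE => /(_ i). Qed.

Lemma coord_cont j : continuous (fun x : 'rV[K]_2 => x 0 j).
Proof. exact: coord_continuous. Qed.

Lemma open_coord_neq0 : open [set x : 'rV[K]_2 | x 0 0 != 0].
Proof.
rewrite openE => x /= x0; apply: (@coord_cont 0 x [set z : K | z != 0]).
apply/nbhs_normP; exists `|x 0 0|; first by rewrite /= normr_gt0.
by move=> w /=; apply: contraTneq => ->; rewrite subr0 ltxx.
Qed.

Lemma Ominus_chart_change_differentiable (x : 'rV[K]_2) : x 0 0 != 0 ->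
  differentiable Ominus_chart_change x.
Proof.
move=> x0.
have dc j : differentiable (fun y : 'rV[K]_2 => y 0 j : K) x.
  exact: differentiable_coord.
have dX m : differentiable (fun y : 'rV[K]_2 => y 0 0 ^+ m : K) x.
  elim: m => [|m IHm]; first exact: differentiable_cst.
  under eq_fun do rewrite exprS.
  exact: differentiableM.
have -> : Ominus_chart_change =
    (fun y : 'rV[K]_2 => (y 0 0)^-1 *: (delta_mx 0 0 : 'rV[K]_2)) +
    (fun y : 'rV[K]_2 => (y 0 0 ^+ k * y 0 1) *: (delta_mx 0 1 : 'rV[K]_2)).
  apply/funext => y; apply/rowP => -[[|[|//]] h]; rewrite !mxE /=.
  - by rewrite mulr1 mulr0 addr0.
  - by rewrite mulr1 mulr0 add0r.
apply: differentiableD; apply: differentiableZl.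
- exact: differentiableV.
- exact: differentiableM.
Qed.

Lemma Ominus_param_open i (U : set 'rV[K]_2) :
  open U -> open (Ominus_param i @` U).
Proof.
move=> oU; rewrite Ominus_openE => j; have [<-|ij] := eqVneq i j.
  suff -> : Ominus_param i @^-1` (Ominus_param i @` U) = U by [].
  apply/seteqP; split => x /=; last by exists x.
  by move=> [y Uy /(@Ominus_param_inj i) <-].
rewrite eq_sym in ij.
have -> : Ominus_param j @^-1` (Ominus_param i @` U) =
    [set x : 'rV[K]_2 | x 0 0 != 0] `&` Ominus_chart_change @^-1` U.
  apply/seteqP; split => x /=.
    by move=> [y Uy /esym /(Ominus_chart_changeP _ _ ij)[x0 <-]].
  move=> [x0 Ux]; exists (Ominus_chart_change x) => //.
  by apply/esym/(Ominus_chart_changeP _ _ ij).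
rewrite openE => x [x0 Ux]; apply: filterI.
  by apply: open_nbhs_nbhs; split => //; exact: open_coord_neq0.
have /differentiable_continuous := Ominus_chart_change_differentiable x0.
by apply; apply: open_nbhs_nbhs.
Qed.

Lemma Ominus_hausdorff : hausdorff_space Ominus_space.
Proof.
rewrite open_hausdorff => p q pq.
have same_chart i x y : Ominus_param i x = p -> Ominus_param i y = q ->
    exists2 AB : set Ominus_space * set Ominus_space,
      (p \in AB.1 /\ q \in AB.2) &
      [/\ open AB.1, open AB.2 & AB.1 `&` AB.2 == set0].
  move=> xp yq; have xy : x != y.
    by apply: contra_neq pq => xy; rewrite -xp -yq xy.
  have := @norm_hausdorff K 'rV[K]_2; rewrite open_hausdorff.
  move=> /(_ _ _ xy)[[A B] /= [xA yB] [oA oB /eqP AB0]].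
  exists (Ominus_param i @` A, Ominus_param i @` B) => /=.
    by split; apply/mem_set; [exists x|exists y] => //; apply: set_mem.
  split; [exact: Ominus_param_open|exact: Ominus_param_open|].
  apply/eqP; rewrite -subset0 => r [[a Aa <-] [b Bb /Ominus_param_inj ba]].
  have : (A `&` B) a by split => //; rewrite -ba.
  by rewrite AB0.
have [i [x xp]] := Ominus_param_cover p.
have [j [y yq]] := Ominus_param_cover q.
have [ij|ij] := eqVneq i j; first by apply: (same_chart i x y) => //; rewrite ij.
have ji : j != i by rewrite eq_sym.
have [x0|x0] := eqVneq (x 0 0) 0; last first.
  apply: (same_chart j (Ominus_chart_change x) y) => //.
  by rewrite -xp; apply/esym/(Ominus_chart_changeP _ _ ij).
have [y0|y0] := eqVneq (y 0 0) 0; last first.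
  apply: (same_chart i x (Ominus_chart_change y)) => //.
  by rewrite -yq; apply/esym/(Ominus_chart_changeP _ _ ji).
pose D := [set z : 'rV[K]_2 | `|z 0 0| < 1].
have oD : open D.
  rewrite openE => z Dz; apply: (@coord_cont 0 z [set t : K | `|t| < 1]).
  apply/nbhs_normP; exists (1 - `|z 0 0|); first by rewrite /= subr_gt0.
  move=> w /=; rewrite distrC => zw; rewrite -[w](subrK (z 0 0)).
  by rewrite (le_lt_trans (ler_normD _ _))// -ltrBrDr.
exists (Ominus_param i @` D, Ominus_param j @` D) => /=.
  split; apply/mem_set; [exists x|exists y] => //; rewrite /D /=.
    by rewrite x0 normr0.
  by rewrite y0 normr0.
split; [exact: Ominus_param_open|exact: Ominus_param_open|].
apply/eqP; rewrite -subset0 => r [[a Da <-] [b Db]].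
move=> /esym /(Ominus_transE _ _ ij)[/(congr1 Num.norm) ab _].
have : `|a 0 0| * `|b 0 0| < 1 by apply: mulr_ilt1.
by rewrite -normrM ab normr1 ltxx.
Qed.

End TotalSpace.

Lemma near_eq_differentiable (K : numFieldType) (V W : normedModType K)
    (f g : V -> W) (x : V) :
  (\near x, f x = g x) -> differentiable f x -> differentiable g x.
Proof.
move=> fg df; have [dfc dfE] := (diff_locallyP _ _).1 df.
have gE : g \o shift x = cst (g x) + 'd f x +o_ 0 id.
  apply/eqaddoP => e e0; move/eqaddoP: dfE => /(_ e e0).
  apply: filterS2; last by move: fg; rewrite (near_shift 0 x) subr0; exact.
  by move=> h; rewrite !fctE /= => <-; rewrite (nbhs_singleton fg).
have dgE := diff_unique dfc gE.
apply/diff_locallyP; split; first by rewrite dgE.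
by rewrite dgE.
Qed.

Lemma Ominus_trans_differentiable (K : numFieldType) (k : nat) (i j : 'I_2)
    (x y : 'rV[K]_2) :
  Ominus_param k i x = Ominus_param k j y ->
  differentiable (chart_trans (Ominus_param k) i j) x.
Proof.
have [<-|ij] := eqVneq i j => xy.
  have -> : chart_trans (@Ominus_param K k) i i = id; last exact: ex_diff.
  apply/funext => z; apply: xget_unique => // w.
  exact: Ominus_param_inj.
have [x0 _] := (@Ominus_chart_changeP K k _ _ _ _ ij).1 xy.
apply: near_eq_differentiable (Ominus_chart_change_differentiable k x0).
have : nbhs x [set z : 'rV[K]_2 | z 0 0 != 0].
  by apply: open_nbhs_nbhs; split => //; exact: open_coord_neq0.
apply: filterS => z /= z0; apply/esym; apply: xget_unique.
  by apply/esym/(@Ominus_chart_changeP K k _ _ _ _ ij).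
by move=> w /esym /(@Ominus_chart_changeP K k _ _ _ _ ij)[].
Qed.

(* The total space of O(-k) as a complex surface. *)
Definition Ominus (K : numFieldType) (k : nat) : cmanifold K 2 :=
  CManifold (@Ominus_param_cover K k) (@Ominus_param_inj K k)
    (@Ominus_param_continuous K k) (@Ominus_param_open K k)
    (@Ominus_hausdorff K k) (@Ominus_trans_differentiable K k).


(** * Calculus on C^n *)

Section RealCalculus.
Variables (R : realType) (n : nat).
Implicit Types (f : 'rV[R[i]]_n -> R) (F : 'rV[R[i]]_n -> R[i]).

(* Derivative along the real line [x + t v], [t] real. *)
Definition rderive (v : 'rV[R[i]]_n) f (x : 'rV[R[i]]_n) : R :=
  derive1 (fun t : R => f (x + t%:C%C *: v)) 0.

(* Class C^m in the sense of the real vector space underlying C^n. *)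
Fixpoint Ck (m : nat) f : Prop :=
  continuous (f : ('rV[R[i]]_n : normedModType R[i]) -> R) /\
  if m is m'.+1 then
    forall v, (forall x, derivable (fun t : R => f (x + t%:C%C *: v)) 0 1) /\
      Ck m' (rderive v f)
  else True.

Definition csmooth F : Prop :=
  forall m, Ck m (fun x => complex.Re (F x)) /\ Ck m (fun x => complex.Im (F x)).

Definition cderive (v : 'rV[R[i]]_n) F (x : 'rV[R[i]]_n) : R[i] :=
  (rderive v (fun y => complex.Re (F y)) x +i*
   rderive v (fun y => complex.Im (F y)) x)%C.

(* Wirtinger operators d/dz_a and d/dzbar_a *)
Definition dz (a : 'I_n) F (x : 'rV[R[i]]_n) : R[i] :=
  (cderive (delta_mx 0 a) F x - 'i%C * cderive ('i%C *: delta_mx 0 a) F x) / 2.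

Definition dzbar (a : 'I_n) F (x : 'rV[R[i]]_n) : R[i] :=
  (cderive (delta_mx 0 a) F x + 'i%C * cderive ('i%C *: delta_mx 0 a) F x) / 2.

Definition C1_curve (c : R -> 'rV[R[i]]_n) : Prop :=
  forall j, [/\ forall t, derivable (fun s : R => complex.Re (c s 0 j)) t 1,
    forall t, derivable (fun s : R => complex.Im (c s 0 j)) t 1,
    continuous (derive1 (fun s : R => complex.Re (c s 0 j))) &
    continuous (derive1 (fun s : R => complex.Im (c s 0 j)))].

Definition velocity (c : R -> 'rV[R[i]]_n) (t : R) : 'rV[R[i]]_n :=
  \row_j ((derive1 (fun s : R => complex.Re (c s 0 j))) t +i*
          (derive1 (fun s : R => complex.Im (c s 0 j))) t)%C.

End RealCalculus.

(** * Hermitian metrics *)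

(* sum_(a, b) G_(a bbar) v_a conj(w_b) *)
Definition hform (R : realType) (n : nat) (G : 'M[R[i]]_n)
    (v w : 'rV[R[i]]_n) : R[i] :=
  \sum_a \sum_b G a b * v 0 a * (w 0 b)^*%C.

Record hermitian_metric (R : realType) (n : nat) (M : cmanifold R[i] n) :=
  HermitianMetric {
    metric_mx :> chart M -> 'rV[R[i]]_n -> 'M[R[i]]_n;
    metric_smooth : forall i a b, csmooth (fun x => metric_mx i x a b);
    metric_herm : forall i x a b, metric_mx i x b a = (metric_mx i x a b)^*%C;
    metric_pos : forall i x v, v != 0 -> 0 < hform (metric_mx i x) v v;
    metric_trans : forall i j x y, param M i x = param M j y -> forall v w,
      hform (metric_mx i x) v w =
      hform (metric_mx j y) ('D_v (chart_trans (param M) i j) x)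
                            ('D_w (chart_trans (param M) i j) x) }.

Section Hermitian.
Variables (R : realType) (n : nat) (M : cmanifold R[i] n).
Variable g : hermitian_metric M.

(* The real 2-form (i/2) sum_(a, b) g_(a bbar) dz_a /\ dzbar_b evaluated on the
   real tangent vectors with complex coordinates [v] and [w]. *)
Definition fundamental_form (i : chart M) (v w x : 'rV[R[i]]_n) : R :=
  - complex.Im (hform (g i x) v w).

(* The exterior derivative of the fundamental form evaluated on the constant,
   hence commuting, vector fields [u], [v] and [w]. *)
Definition d_fundamental_form (i : chart M) (u v w x : 'rV[R[i]]_n) : R :=
  rderive u (fundamental_form i v w) x + rderive v (fundamental_form i w u) x
  + rderive w (fundamental_form i u v) x.

Definition kahler : Prop := forall i u v w x, d_fundamental_form i u v w x = 0.

Definition curve_length (i : chart M) (c : R -> 'rV[R[i]]_n) : \bar R :=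
  (\int[lebesgue_measure]_(t in `[0%R, 1%R])
     (Num.sqrt (complex.Re
        (hform (g i (c t)) (velocity c t) (velocity c t))))%:E)%E.

(* [pw_path p q L]: some piecewise C^1 curve from p to q has length L.  Curves
   are cut into pieces contained in one chart; each piece is the restriction to
   [0, 1] of a C^1 map on the real line. *)
Inductive pw_path : M -> M -> \bar R -> Prop :=
| pw_path_nil p : pw_path p p 0%E
| pw_path_cons i c q L : C1_curve c -> pw_path (param M i (c 1)) q L ->
    pw_path (param M i (c 0)) q (curve_length i c + L)%E.

Definition riem_dist (p q : M) : \bar R := ereal_inf [set L | pw_path p q L].

Definition complete_metric : Prop := forall u : nat -> M,
  (forall e : R, 0 < e -> exists N, forall l m, (N <= l)%N -> (N <= m)%N ->
     (riem_dist (u l) (u m) < e%:E)%E) ->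
  exists p, forall e : R, 0 < e -> exists N, forall m, (N <= m)%N ->
     (riem_dist (u m) p < e%:E)%E.

(* R_(a bbar c dbar); g^(p qbar) is the (p, q) entry of the inverse matrix. *)
Definition curvature (i : chart M) (x : 'rV[R[i]]_n) (a b c d : 'I_n) : R[i] :=
  - dz c (dzbar d (fun y => g i y a b)) x
  + \sum_p \sum_q invmx (g i x) p q *
      dz c (fun y => g i y a p) x * dzbar d (fun y => g i y q b) x.

(* Meant for nonzero [v], the coordinates of a tangent vector at [param i x]. *)
Definition hol_sect_curv (i : chart M) (x v : 'rV[R[i]]_n) : R[i] :=
  (\sum_a \sum_b \sum_c \sum_d curvature i x a b c d *
     v 0 a * (v 0 b)^*%C * v 0 c * (v 0 d)^*%C) /
  (\sum_a \sum_b \sum_c \sum_d g i x a b * g i x c d *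
     v 0 a * (v 0 b)^*%C * v 0 c * (v 0 d)^*%C).

Definition semipositive_hsc : Prop :=
  forall i x v, v != 0 -> 0 <= hol_sect_curv i x v.

(* Coordinates identify the tangent space at p with C^n; the choice of a chart
   around p is immaterial. *)
Definition has_flat_subspace (p : M) (k : nat) : Prop :=
  exists i x (L : {vspace 'rV[R[i]]_n}),
    [/\ param M i x = p, \dim L = k &
      forall v, v \in L -> v != 0 -> hol_sect_curv i x v = 0].

Definition eta (p : M) : nat :=
  \max_(k < n.+1 | `[< has_flat_subspace p k >]) k.

(* The minimum of [eta] over M, which takes its values in {0, ..., n}. *)
Definition eta_min : nat :=
  \big[minn/n]_(k < n.+1 | `[< exists p, eta p = k >]) k.

Definition rank_plus : nat := n - eta_min.

End Hermitian.

(* Main.v *)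
(* The total space of O(-k) is the Kahler quotient of C^3, with its flat metric, by
   the circle acting with weights (1, 1, -k), at a positive level of the moment
   map mu = |a|^2 + |b|^2 - k |w|^2. Gauss' and O'Neill's formulas show that, up to
   positive factors, the holomorphic sectional curvature of the quotient along a
   tangent vector is the square of the Hessian of mu on its horizontal lift.
   Hence it is nonnegative, and since the Hessian has signature (1, 1) on the
   horizontal space, some lines but no planes are flat at each point. The
   metric is complete because sqrt (|a|^2 + |b|^2) is a Lipschitz function with
   compact sublevel sets.
   In the two charts (z, u) of O(-k) the quotient metric is given by one formula,
   explicit up to the value Y of k |w|^2 on the level set, which solves
   Y (1 + Y) ^ k = |u|^2 (1 + |z|^2) ^ k after rescaling u. *)

Require Import Defs.
From mathcomp Require Import all_boot all_order all_algebra.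
From mathcomp Require Import complex.
From mathcomp Require Import all_classical all_reals all_analysis.
From mathcomp Require Import measurable_realfun ring lra.

Set Implicit Arguments.
Unset Strict Implicit.
Unset Printing Implicit Defensive.

Import Order.TTheory GRing.Theory Num.Theory.
Import numFieldNormedType.Exports.

Local Open Scope classical_set_scope.
Local Open Scope ring_scope.

Local Notation Re := complex.Re.
Local Notation Im := complex.Im.

(** * Smooth functions on C^n and their Wirtinger derivatives *)

(** The equation for Y comes from the complexified action (a, b, w) -> (l a, l b, l^(-k) w): on (a,
    b) nonzero its quotient is O(-k), with z = b / a and u = w a^k in the chart where a is nonzero.
    The invariant |w|^2 (|a|^2 + |b|^2)^k equals |u|^2 (1 + |z|^2)^k in the chart and Y (1 + Y)^k /
    k on the level set mu = 1; replacing u by sqrt k u absorbs the k. Gauss and O'Neill only predict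
    the answer. No quotient is formed: a metric is written down in coordinates and its curvature is
    computed from the definition. Two facts make this tractable. The coframe [horiz], [vert]
    diagonalizes the metric, and its derivatives are again polynomial in the coframe and the
    coordinates. The equation for Y makes the fibre coefficient times |u|^2 rational in Y, so that
    everything ends in one identity of rational functions. Since Y is known only implicitly,
    smoothness is obtained by bootstrapping: the differential of Y is a rational expression in Y and
    the differential of an explicit function. *)

Section ComplexCurves.
Variable R : realType.
Implicit Types (f g : R -> R[i]) (t : R) (x y d e : R[i]).

Lemma Re_add x y : Re (x + y) = Re x + Re y. Proof. by case: x; case: y. Qed.
Lemma Im_add x y : Im (x + y) = Im x + Im y. Proof. by case: x; case: y. Qed.
Lemma Re_mul x y : Re (x * y) = Re x * Re y - Im x * Im y.
Proof. by case: x; case: y. Qed.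
Lemma Im_mul x y : Im (x * y) = Re x * Im y + Im x * Re y.
Proof. by case: x; case: y. Qed.
Lemma Re_conjc x : Re x^*%C = Re x. Proof. by case: x. Qed.
Lemma Im_conjc x : Im x^*%C = - Im x. Proof. by case: x. Qed.
Lemma conjcD x y : (x + y)^*%C = x^*%C + y^*%C. Proof. exact: rmorphD. Qed.
Lemma conjcM x y : (x * y)^*%C = x^*%C * y^*%C. Proof. exact: rmorphM. Qed.
Lemma conjcN x : (- x)^*%C = - x^*%C. Proof. exact: rmorphN. Qed.
Lemma conjcB x y : (x - y)^*%C = x^*%C - y^*%C. Proof. exact: rmorphB. Qed.
Lemma conjcX x m : (x ^+ m)^*%C = x^*%C ^+ m. Proof. exact: rmorphXn. Qed.
Lemma complex_eq x y : Re x = Re y -> Im x = Im y -> x = y.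
Proof. by case: x; case: y => a b c d /= -> ->. Qed.

Definition cder f t d :=
  is_derive t 1 (fun s => Re (f s)) (Re d) /\
  is_derive t 1 (fun s => Im (f s)) (Im d).

Lemma cder_eq f t d e : cder f t d -> d = e -> cder f t e.
Proof. by move=> h <-. Qed.

Lemma cder_cst c t : cder (fun=> c) t 0.
Proof. by split; exact: is_derive_cst. Qed.

Lemma cderD f g t d e : cder f t d -> cder g t e ->
  cder (fun s => f s + g s) t (d + e).
Proof.
move=> [f1 f2] [g1 g2]; split.
  by under eq_fun do rewrite Re_add; rewrite Re_add; exact: is_deriveD.
by under eq_fun do rewrite Im_add; rewrite Im_add; exact: is_deriveD.
Qed.

Lemma cderM f g t d e : cder f t d -> cder g t e ->
  cder (fun s => f s * g s) t (d * g t + f t * e).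
Proof.
move=> [f1 f2] [g1 g2]; split.
  under eq_fun do rewrite Re_mul; rewrite Re_add !Re_mul.
  have := is_deriveB (is_deriveM f1 g1) (is_deriveM f2 g2).
  by move/is_derive_eq; apply; rewrite /GRing.scale/=; ring.
under eq_fun do rewrite Im_mul; rewrite Im_add !Im_mul.
have := is_deriveD (is_deriveM f1 g2) (is_deriveM f2 g1).
by move/is_derive_eq; apply; rewrite /GRing.scale/=; ring.
Qed.

Lemma cder_conj f t d : cder f t d -> cder (fun s => (f s)^*%C) t d^*%C.
Proof.
move=> [f1 f2]; split.
  by under eq_fun do rewrite Re_conjc; rewrite Re_conjc.
by under eq_fun do rewrite Im_conjc; rewrite Im_conjc; exact: is_deriveN.
Qed.

Lemma cderV f t d : f t != 0 -> cder f t d ->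
  cder (fun s => (f s)^-1) t (- d / f t ^+ 2).
Proof.
move=> f0 [f1 f2].
have n0 : Re (f t) ^+ 2 + Im (f t) ^+ 2 != 0.
  apply: contra_neq f0 => /eqP; rewrite paddr_eq0 ?sqr_ge0// !sqrf_eq0.
  by move=> /andP[/eqP h1 /eqP h2]; exact: complex_eq.
have dn : is_derive t 1 (fun s => (Re (f s) ^+ 2 + Im (f s) ^+ 2)^-1)
    (- (Re (f t) ^+ 2 + Im (f t) ^+ 2) ^- 2 *
     (2 * Re (f t) * Re d + 2 * Im (f t) * Im d)).
  apply: is_deriveV => //.
  have := is_deriveD (is_deriveX 2 f1) (is_deriveX 2 f2).
  by move/is_derive_eq; apply; rewrite /GRing.scale/=.
have ReV x : Re x^-1 = Re x * (Re x ^+ 2 + Im x ^+ 2)^-1 by case: x.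
have ImV x : Im x^-1 = - Im x * (Re x ^+ 2 + Im x ^+ 2)^-1.
  by case: x => a b /=; rewrite mulNr.
have fE : f t ^+ 2 = ((Re (f t) ^+ 2 - Im (f t) ^+ 2) +i* (2 * Re (f t) * Im (f t)))%C.
  by case: (f t) => a b; apply: complex_eq; rewrite /=; ring.
have n1 : Re (f t ^+ 2) ^+ 2 + Im (f t ^+ 2) ^+ 2 = (Re (f t) ^+ 2 + Im (f t) ^+ 2) ^+ 2.
  by rewrite fE/=; ring.
have ReN x : Re (- x) = - Re x by case: x.
have ImN x : Im (- x) = - Im x by case: x.
split.
  under eq_fun do rewrite ReV; have := is_deriveM f1 dn.
  move/is_derive_eq; apply; rewrite Re_mul ReV ImV n1 fE ReN ImN/= /GRing.scale/=.
  by field.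
under eq_fun do rewrite ImV; have := is_deriveM (is_deriveN f2) dn.
move/is_derive_eq; apply; rewrite Im_mul ReV ImV n1 fE ReN ImN/= /GRing.scale/=.
  by rewrite fctE; field.
Qed.

Lemma cder_real (f : R -> R) t (d : R) :
  is_derive t 1 f d -> cder (fun s => (f s)%:C%C) t d%:C%C.
Proof. by move=> fd; split => //=; exact: is_derive_cst. Qed.

End ComplexCurves.

Section ContinuousOps.
Variables (K : numFieldType) (T : topologicalType) (f g : T -> K).

Lemma continuous_add : continuous f -> continuous g ->
  continuous (fun x => f x + g x).
Proof. by move=> fc gc x; apply: cvgD; [exact: fc|exact: gc]. Qed.

Lemma continuous_mul : continuous f -> continuous g ->
  continuous (fun x => f x * g x).
Proof. by move=> fc gc x; apply: cvgM; [exact: fc|exact: gc]. Qed.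

Lemma continuous_inv : (forall x, f x != 0) -> continuous f ->
  continuous (fun x => (f x)^-1).
Proof. by move=> f0 fc x; apply: cvgV; [exact: f0|exact: fc]. Qed.

End ContinuousOps.

Section SmoothFunctions.
Variables (R : realType) (n : nat).
Local Notation C := (R[i]).
Local Notation K := (R[i] : numFieldType).
Local Notation VN := ('rV[R[i]]_n : normedModType R[i]).
Local Notation V := ('rV[C]_n).
Implicit Types (F G : V -> C) (P Q : 'I_n -> V -> C) (x u w : V) (c : R -> V).

Definition ccurve c (t : R) w := forall j, cder (fun s => c s 0 j) t (w 0 j).

(* The differential of [F] is [sum_j (P j dz_j + Q j dzbar_j)], in the form of
   a chain rule along curves. *)
Definition has_diff F P Q := forall c t w, ccurve c t w ->
  cder (fun s => F (c s)) t
    (\sum_j (P j (c t) * w 0 j + Q j (c t) * (w 0 j)^*%C)).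

(** Unlike [Ck], which speaks of every real direction, this class is visibly stable under sums,
    products, conjugates and inverses, and under implicit definitions whose partials involve the
    function itself. *)
Fixpoint smooth_upto (m : nat) F : Prop :=
  continuous (F : VN -> K) /\ exists P Q, has_diff F P Q /\
  (if m is m'.+1 then forall j, smooth_upto m' (P j) /\ smooth_upto m' (Q j)
   else True).

Definition smooth F := forall m, smooth_upto m F.

Lemma ccurve_line x w t : ccurve (fun s => x + s%:C%C *: w) t w.
Proof.
move=> j; under eq_fun do rewrite !mxE.
have h : cder (fun s : R => s%:C%C) t 1.
  by apply: (@cder_real _ id t 1); exact: is_derive_id.
apply: cder_eq (cderD (cder_cst _ _) (cderM h (cder_cst _ _))) _.
by rewrite mul1r mulr0 addr0 add0r.
Qed.

Lemma cderiveE F P Q w x : has_diff F P Q ->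
  cderive w F x = \sum_j (P j x * w 0 j + Q j x * (w 0 j)^*%C).
Proof.
move=> FPQ; have := FPQ _ 0 _ (ccurve_line x w 0).
rewrite scale0r addr0 => -[h1 h2]; apply: complex_eq => /=.
  by rewrite /rderive derive1E (@derive_val _ _ _ _ _ _ _ h1).
by rewrite /rderive derive1E (@derive_val _ _ _ _ _ _ _ h2).
Qed.

Lemma sum_delta (f : 'I_n -> C) (a : 'I_n) (l : C) :
  \sum_j f j * (l *: delta_mx 0 a : V) 0 j = f a * l.
Proof.
rewrite (bigD1 a)//= big1 => [|j ja]; first by rewrite !mxE !eqxx addr0 mulr1.
by rewrite !mxE eqxx (negPf ja) !mulr0.
Qed.

Lemma sum_deltaJ (f : 'I_n -> C) (a : 'I_n) (l : C) :
  \sum_j f j * ((l *: delta_mx 0 a : V) 0 j)^*%C = f a * l^*%C.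
Proof.
rewrite (bigD1 a)//= big1 => [|j ja]; first by rewrite !mxE !eqxx addr0 mulr1.
by rewrite !mxE eqxx (negPf ja) mulr0 rmorph0 mulr0.
Qed.

Lemma cderive_delta F P Q (l : C) a x : has_diff F P Q ->
  cderive (l *: delta_mx 0 a) F x = P a x * l + Q a x * l^*%C.
Proof.
move=> /cderiveE ->; rewrite big_split/=.
by rewrite (sum_delta (P ^~ x)) (sum_deltaJ (Q ^~ x)).
Qed.

(** The directions e_a and i e_a give P + Q and i (P - Q), which the Wirtinger combination
    separates. Hence the coefficients in [has_diff] are unique. *)
Lemma dzE F P Q a x : has_diff F P Q -> dz a F x = P a x.
Proof.
move=> h; rewrite /dz -[delta_mx 0 a in X in X - _]scale1r !(cderive_delta _ _ _ h).
have -> : ('i%C : C)^*%C = - 'i%C by apply: complex_eq; rewrite /= ?oppr0.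
rewrite conjc1; have := sqr_i R; rewrite expr2 => i2.
have -> : P a x * 1 + Q a x * 1 - 'i%C * (P a x * 'i%C + Q a x * - 'i%C) =
  P a x * (1 - 'i%C * 'i%C) + Q a x * (1 + 'i%C * 'i%C) by ring.
by rewrite i2 subrr mulr0 addr0; field.
Qed.

Lemma dzbarE F P Q a x : has_diff F P Q -> dzbar a F x = Q a x.
Proof.
move=> h; rewrite /dzbar -[delta_mx 0 a in X in X + _]scale1r !(cderive_delta _ _ _ h).
have -> : ('i%C : C)^*%C = - 'i%C by apply: complex_eq; rewrite /= ?oppr0.
rewrite conjc1; have := sqr_i R; rewrite expr2 => i2.
have -> : P a x * 1 + Q a x * 1 + 'i%C * (P a x * 'i%C + Q a x * - 'i%C) =
  P a x * (1 + 'i%C * 'i%C) + Q a x * (1 - 'i%C * 'i%C) by ring.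
by rewrite i2 subrr mulr0 add0r; field.
Qed.

Lemma smooth_uptoW m F : smooth_upto m.+1 F -> smooth_upto m F.
Proof.
elim: m F => [|m IHm] F [Fc [P [Q [h hs]]]]; split => //; exists P, Q; split => //.
by move=> j; have [h1 h2] := hs j; split; apply: IHm.
Qed.

Lemma smooth_diff F : smooth F -> has_diff F (fun j => dz j F) (fun j => dzbar j F).
Proof.
move=> /(_ 0%N) [_ [P [Q [h _]]]].
have -> : (fun j => dz j F) = P by apply/funext=> j; apply/funext=> x; exact: dzE h.
have -> : (fun j => dzbar j F) = Q.
  by apply/funext=> j; apply/funext=> x; exact: dzbarE h.
exact: h.
Qed.

(** The witnesses for different orders [m] coincide by uniqueness of the coefficients, so one order
    can be spent on the derivative. *)
Lemma smooth_dz F j : smooth F -> smooth (dz j F).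
Proof.
move=> sF m; have [_ [P [Q [h /(_ j)[hs _]]]]] := sF m.+1.
by have -> : dz j F = P j by apply/funext=> x; exact: dzE h.
Qed.

Lemma smooth_dzbar F j : smooth F -> smooth (dzbar j F).
Proof.
move=> sF m; have [_ [P [Q [h /(_ j)[_ hs]]]]] := sF m.+1.
by have -> : dzbar j F = Q j by apply/funext=> x; exact: dzbarE h.
Qed.

Lemma smooth_continuous F : smooth F -> continuous (F : VN -> K).
Proof. by move=> /(_ 0%N)[]. Qed.

Lemma smooth_upto_cst m (l : C) : smooth_upto m (fun=> l).
Proof.
elim: m l => [|m IHm] l; (split; first exact: (@cst_continuous VN K l));
  exists (fun _ _ => 0), (fun _ _ => 0); split=> //.
- move=> c t w _; apply: cder_eq (cder_cst _ _) _.
  by rewrite big1// => j _; rewrite !mul0r addr0.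
- move=> c t w _; apply: cder_eq (cder_cst _ _) _.
  by rewrite big1// => j _; rewrite !mul0r addr0.
Qed.

Lemma has_diff_coord a :
  has_diff (fun x => x 0 a) (fun j _ => (j == a)%:R) (fun _ _ => 0).
Proof.
move=> c t w /(_ a) h; apply: cder_eq h _.
rewrite (bigD1 a)//= big1 => [|j /negPf ->]; last by rewrite !mul0r addr0.
by rewrite eqxx !mul0r !addr0 mul1r.
Qed.

Lemma smooth_upto_coord m a : smooth_upto m (fun x => x 0 a).
Proof.
case: m => [|m]; (split; first exact: (@coord_continuous (R[i] : numFieldType)));
  (exists (fun j _ => (j == a)%:R), (fun _ _ => 0)); split=> //.
- exact: has_diff_coord.
- exact: has_diff_coord.
- by move=> j; split; exact: smooth_upto_cst.
Qed.

Lemma has_diffD F G P Q P' Q' : has_diff F P Q -> has_diff G P' Q' ->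
  has_diff (fun x => F x + G x) (fun j x => P j x + P' j x)
    (fun j x => Q j x + Q' j x).
Proof.
move=> hF hG c t w h; apply: cder_eq (cderD (hF _ _ _ h) (hG _ _ _ h)) _.
by rewrite -big_split; apply: eq_bigr => j _ /=; ring.
Qed.

Lemma has_diffM F G P Q P' Q' : has_diff F P Q -> has_diff G P' Q' ->
  has_diff (fun x => F x * G x) (fun j x => P j x * G x + F x * P' j x)
    (fun j x => Q j x * G x + F x * Q' j x).
Proof.
move=> hF hG c t w h; apply: cder_eq (cderM (hF _ _ _ h) (hG _ _ _ h)) _.
by rewrite mulr_suml mulr_sumr -big_split; apply: eq_bigr => j _ /=; ring.
Qed.

Lemma has_diffJ F P Q : has_diff F P Q ->
  has_diff (fun x => (F x)^*%C) (fun j x => (Q j x)^*%C)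
    (fun j x => (P j x)^*%C).
Proof.
move=> hF c t w h; apply: cder_eq (cder_conj (hF _ _ _ h)) _.
rewrite rmorph_sum; apply: eq_bigr => j _ /=.
by rewrite rmorphD !rmorphM/= conjcK addrC.
Qed.

(** The partials are spelled as products of [P] or [Q], a constant and the inverse itself, so that
    the induction on the order closes with [smooth_uptoM] alone. *)
Lemma has_diffV F P Q : (forall x, F x != 0) -> has_diff F P Q ->
  has_diff (fun x => (F x)^-1) (fun j x => - 1 * (P j x * ((F x)^-1 * (F x)^-1)))
    (fun j x => - 1 * (Q j x * ((F x)^-1 * (F x)^-1))).
Proof.
move=> F0 hF c t w h; apply: cder_eq (cderV (F0 _) (hF _ _ _ h)) _.
rewrite mulNr mulr_suml -sumrN; apply: eq_bigr => j _ /=.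
by field; exact: F0.
Qed.

Lemma smooth_uptoD m F G : smooth_upto m F -> smooth_upto m G ->
  smooth_upto m (fun x => F x + G x).
Proof.
elim: m F G => [|m IHm] F G [Fc [P [Q [hF sF]]]] [Gc [P' [Q' [hG sG]]]];
  (split; first exact (@continuous_add K VN F G Fc Gc));
  do 2 eexists; (split; first exact: has_diffD hF hG) => //.
by move=> j; have [? ?] := sF j; have [? ?] := sG j; split; apply: IHm.
Qed.

Lemma smooth_uptoM m F G : smooth_upto m F -> smooth_upto m G ->
  smooth_upto m (fun x => F x * G x).
Proof.
elim: m F G => [|m IHm] F G sF sG; have := sF; have := sG;
  move=> [Gc [P' [Q' [hG sG']]]] [Fc [P [Q [hF sF']]]];
  (split; first exact (@continuous_mul K VN F G Fc Gc));
  do 2 eexists; (split; first exact: has_diffM hF hG) => //.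
move=> j; have [? ?] := sF' j; have [? ?] := sG' j.
by split; apply: smooth_uptoD; apply: IHm => //; exact: smooth_uptoW.
Qed.

Lemma conjc_continuous : continuous (fun z : K => z^*%C : K).
Proof.
move=> z A /nbhs_normP[e e0 eA]; apply/nbhs_normP; exists e => //= w zw.
by apply: eA => /=; rewrite -rmorphB normcJ.
Qed.

Lemma smooth_uptoJ m F : smooth_upto m F -> smooth_upto m (fun x => (F x)^*%C).
Proof.
elim: m F => [|m IHm] F [Fc [P [Q [hF sF]]]];
  (split; first by move=> x; apply: (@continuous_comp VN K K F);
    [exact: Fc|exact: conjc_continuous]);
  do 2 eexists; (split; first exact: has_diffJ hF) => //.
by move=> j; have [? ?] := sF j; split; apply: IHm.
Qed.

Lemma smooth_uptoV m F : (forall x, F x != 0) -> smooth_upto m F ->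
  smooth_upto m (fun x => (F x)^-1).
Proof.
move=> F0; elim: m => [|m IHm] sF; have := sF; move=> [Fc [P [Q [hF sF']]]];
  (split; first exact (@continuous_inv K VN F F0 Fc));
  do 2 eexists; (split; first exact: has_diffV F0 hF) => //.
have sV := IHm (smooth_uptoW sF).
move=> j; have [? ?] := sF' j.
by split; (apply: smooth_uptoM; first exact: smooth_upto_cst);
  do 2 (apply: smooth_uptoM => //).
Qed.

Lemma smooth_cst l : smooth (fun=> l).
Proof. by move=> m; exact: smooth_upto_cst. Qed.

Lemma smooth_coord a : smooth (fun x => x 0 a).
Proof. by move=> m; exact: smooth_upto_coord. Qed.

Lemma smoothD F G : smooth F -> smooth G -> smooth (fun x => F x + G x).
Proof. by move=> sF sG m; exact: smooth_uptoD. Qed.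

Lemma smoothM F G : smooth F -> smooth G -> smooth (fun x => F x * G x).
Proof. by move=> sF sG m; exact: smooth_uptoM. Qed.

Lemma smoothJ F : smooth F -> smooth (fun x => (F x)^*%C).
Proof. by move=> sF m; exact: smooth_uptoJ. Qed.

Lemma smoothV F : (forall x, F x != 0) -> smooth F -> smooth (fun x => (F x)^-1).
Proof. by move=> F0 sF m; exact: smooth_uptoV. Qed.

Lemma smooth_sum (I : Type) (r : seq I) (F : I -> V -> C) :
  (forall i, smooth (F i)) -> smooth (fun x => \sum_(i <- r) F i x).
Proof.
move=> sF; elim: r => [|i r IHr].
  by under eq_fun do rewrite big_nil; exact: smooth_cst.
by under eq_fun do rewrite big_cons; exact: smoothD.
Qed.

Definition del u F x := \sum_j dz j F x * u 0 j.
Definition delbar u F x := \sum_j dzbar j F x * (u 0 j)^*%C.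

Lemma smooth_del u F : smooth F -> smooth (del u F).
Proof.
move=> sF; apply: smooth_sum => j; apply: smoothM; last exact: smooth_cst.
exact: smooth_dz.
Qed.

Lemma smooth_delbar u F : smooth F -> smooth (delbar u F).
Proof.
move=> sF; apply: smooth_sum => j; apply: smoothM; last exact: smooth_cst.
exact: smooth_dzbar.
Qed.

Lemma cder_comp F c t w : smooth F -> ccurve c t w ->
  cder (fun s => F (c s)) t (del w F (c t) + delbar w F (c t)).
Proof.
by move=> /smooth_diff h /h; move/cder_eq; apply; rewrite big_split.
Qed.

Lemma Re_continuous : continuous (@complex.Re R : K -> R).
Proof.
move=> z A /nbhs_normP[e e0 eA]; apply/nbhs_normP; exists e%:C%C.
  by rewrite /= ltcR.
move=> w /= zw; apply: eA => /=.
have := le_lt_trans (normc_ge_Re (z - w)) zw.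
by rewrite ltcR; case: (z) (w) => a b [].
Qed.

Lemma Im_continuous : continuous (@complex.Im R : K -> R).
Proof.
move=> z A /nbhs_normP[e e0 eA]; apply/nbhs_normP; exists e%:C%C.
  by rewrite /= ltcR.
move=> w /= zw; apply: eA => /=.
(* Multiplication by i preserves the modulus and turns the imaginary part into a real part, up to
   sign. *)
have := normc_ge_Re ((z - w) * 'i%C).
rewrite normrM complexiE normCi mulr1 -complexiE ReiNIm normrN => h.
have := le_lt_trans h zw.
by rewrite ltcR; case: (z) (w) => a b [].
Qed.

Lemma smooth_Re_continuous F : smooth F ->
  continuous ((fun x => Re (F x)) : VN -> R).
Proof.
move=> sF x; have Fc := smooth_continuous sF.
exact (@continuous_comp VN K R F (@complex.Re R) x (Fc x) (@Re_continuous (F x))).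
Qed.

Lemma smooth_Im_continuous F : smooth F ->
  continuous ((fun x => Im (F x)) : VN -> R).
Proof.
move=> sF x; have Fc := smooth_continuous sF.
exact (@continuous_comp VN K R F (@complex.Im R) x (Fc x) (@Im_continuous (F x))).
Qed.

Lemma rderive_Re w F x : smooth F ->
  rderive w (fun y => Re (F y)) x = Re (del w F x + delbar w F x).
Proof. by move=> /smooth_diff/cderiveE; rewrite /del /delbar -big_split => <-. Qed.

Lemma rderive_Im w F x : smooth F ->
  rderive w (fun y => Im (F y)) x = Im (del w F x + delbar w F x).
Proof. by move=> /smooth_diff/cderiveE; rewrite /del /delbar -big_split => <-. Qed.

(** A real directional derivative of [Re (F x)] is the real part of [del w F + delbar w F], again a
    smooth function; likewise for [Im]. The induction therefore never leaves real and imaginary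
    parts of smooth functions. *)
Lemma smooth_Ck F m : smooth F -> Ck m (fun x => Re (F x)) /\ Ck m (fun x => Im (F x)).
Proof.
elim: m F => [|m IHm] F sF.
  split; split => //.
    exact: smooth_Re_continuous.
  exact: smooth_Im_continuous.
split; (split; [|move=> w; split; [move=> x|]]).
- exact: smooth_Re_continuous.
- by have [[]] := cder_comp sF (ccurve_line x w 0).
- have -> : rderive w (fun x => Re (F x)) = fun x => Re (del w F x + delbar w F x).
    by apply/funext => x; rewrite rderive_Re.
  by apply: (IHm _ _).1; apply: smoothD; [exact: smooth_del|exact: smooth_delbar].
- exact: smooth_Im_continuous.
- by have [_ []] := cder_comp sF (ccurve_line x w 0).
- have -> : rderive w (fun x => Im (F x)) = fun x => Im (del w F x + delbar w F x).
    by apply/funext => x; rewrite rderive_Im.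
  by apply: (IHm _ _).2; apply: smoothD; [exact: smooth_del|exact: smooth_delbar].
Qed.

Lemma smooth_csmooth F : smooth F -> csmooth F.
Proof. by move=> sF m; exact: smooth_Ck. Qed.

End SmoothFunctions.

(** * A calculus of first derivatives along constant vector fields *)

Section Wirtinger.
Variables (R : realType) (n : nat).
Local Notation C := (R[i]).
Local Notation V := ('rV[C]_n).
Implicit Types (F G : V -> C) (u x : V) (p q l : C).

Lemma smoothX F m : smooth F -> smooth (fun x => F x ^+ m).
Proof.
move=> sF; elim: m => [|m IHm].
  by under eq_fun do rewrite expr0; exact: smooth_cst.
by under eq_fun do rewrite exprS; exact: smoothM.
Qed.

(** Smoothness travels with the two values, so that the derivative of a composite expression is
    obtained by nesting the rules below along its syntax, followed by one [ring] or [field]. *)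
Definition has_del u F x p q := [/\ smooth F, del u F x = p & delbar u F x = q].

Lemma has_del_eq u F x p q p' q' : has_del u F x p q -> p = p' -> q = q' ->
  has_del u F x p' q'.
Proof. by move=> h <- <-. Qed.

Lemma has_del_self u F x : smooth F -> has_del u F x (del u F x) (delbar u F x).
Proof. by []. Qed.

Lemma has_del_of F P Q u x : smooth F -> has_diff F P Q ->
  has_del u F x (\sum_j P j x * u 0 j) (\sum_j Q j x * (u 0 j)^*%C).
Proof.
by move=> sF h; split => //; apply: eq_bigr => j _; rewrite (dzE _ _ h, dzbarE _ _ h).
Qed.

Lemma has_del_cst u x l : has_del u (fun=> l) x 0 0.
Proof.
have h : has_diff (fun _ : V => l) (fun _ _ => 0) (fun _ _ => 0).
  move=> c t w _; apply: cder_eq (cder_cst _ _) _.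
  by rewrite big1// => j _; rewrite !mul0r addr0.
apply: has_del_eq (has_del_of _ _ (@smooth_cst _ _ _) h) _ _;
  by rewrite big1// => j _; rewrite mul0r.
Qed.

Lemma has_del_coord u x a : has_del u (fun y => y 0 a) x (u 0 a) 0.
Proof.
apply: has_del_eq (has_del_of _ _ (@smooth_coord _ _ _) (@has_diff_coord _ _ _)) _ _.
  rewrite (bigD1 a)//= big1 => [|j /negPf ->]; last by rewrite mul0r.
  by rewrite eqxx mul1r addr0.
by rewrite big1// => j _; rewrite mul0r.
Qed.

Lemma has_delD u F G x p q p' q' : has_del u F x p q -> has_del u G x p' q' ->
  has_del u (fun y => F y + G y) x (p + p') (q + q').
Proof.
move=> [sF <- <-] [sG <- <-].
apply: has_del_eq (has_del_of _ _ (smoothD sF sG)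
    (has_diffD (smooth_diff sF) (smooth_diff sG))) _ _;
  by rewrite -big_split; apply: eq_bigr => j _; rewrite mulrDl.
Qed.

Lemma has_delM u F G x p q p' q' : has_del u F x p q -> has_del u G x p' q' ->
  has_del u (fun y => F y * G y) x (p * G x + F x * p') (q * G x + F x * q').
Proof.
move=> [sF <- <-] [sG <- <-].
apply: has_del_eq (has_del_of _ _ (smoothM sF sG)
    (has_diffM (smooth_diff sF) (smooth_diff sG))) _ _;
  by rewrite mulr_suml mulr_sumr -big_split; apply: eq_bigr => j _ /=; ring.
Qed.

Lemma has_delZ u F x p q l : has_del u F x p q ->
  has_del u (fun y => l * F y) x (l * p) (l * q).
Proof.
by move=> h; apply: has_del_eq (has_delM (has_del_cst _ _ _) h) _ _; rewrite mul0r add0r.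
Qed.

Lemma has_delN u F x p q : has_del u F x p q ->
  has_del u (fun y => - F y) x (- p) (- q).
Proof.
under eq_fun do rewrite -mulN1r.
by rewrite -(mulN1r p) -(mulN1r q); exact: has_delZ.
Qed.

Lemma has_delB u F G x p q p' q' : has_del u F x p q -> has_del u G x p' q' ->
  has_del u (fun y => F y - G y) x (p - p') (q - q').
Proof. by move=> h h'; apply: has_delD => //; exact: has_delN. Qed.

Lemma has_delJ u F x p q : has_del u F x p q ->
  has_del u (fun y => (F y)^*%C) x q^*%C p^*%C.
Proof.
move=> [sF <- <-].
apply: has_del_eq (has_del_of _ _ (smoothJ sF) (has_diffJ (smooth_diff sF))) _ _;
  by rewrite rmorph_sum; apply: eq_bigr => j _; rewrite [RHS]conjcM ?conjcK.
Qed.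

Lemma has_delV u F x p q : (forall y, F y != 0) -> has_del u F x p q ->
  has_del u (fun y => (F y)^-1) x (- p / F x ^+ 2) (- q / F x ^+ 2).
Proof.
move=> F0 [sF <- <-].
apply: has_del_eq (has_del_of _ _ (smoothV F0 sF) (has_diffV F0 (smooth_diff sF))) _ _;
  rewrite mulNr mulr_suml -sumrN; apply: eq_bigr => j _ /=; by field; exact: F0.
Qed.

Lemma has_delX u F x p q m : has_del u F x p q ->
  has_del u (fun y => F y ^+ m.+1) x (m.+1%:R * F x ^+ m * p) (m.+1%:R * F x ^+ m * q).
Proof.
move=> h; elim: m => [|m IHm].
  by under eq_fun do rewrite expr1; rewrite expr0 !mul1r.
under eq_fun do rewrite exprS; apply: has_del_eq (has_delM h IHm) _ _;
  by rewrite -[m.+2]addn1 natrD exprS; ring.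
Qed.

End Wirtinger.

(** * The moment map *)

Section Moment.
Variables (R : realType) (m : nat).
Implicit Types a b r s t : R.

Definition rho_of_moment a := a * (1 + a) ^+ m.+1.

(* The slope of [rho_of_moment] between [a] and [b]. Using it rather than the
   inverse function theorem makes [moment] differentiable along every
   nonnegative differentiable function, also where that function vanishes. *)
Definition secant a b :=
  (1 + a) ^+ m.+1 + b * \sum_(i < m.+1) (1 + a) ^+ (m - i) * (1 + b) ^+ i.

(** With k = m + 1, the difference is (a - b) (1 + a)^k + b ((1 + a)^k - (1 + b)^k), and the last
    bracket factors as a geometric sum. *)
Lemma secantE a b :
  rho_of_moment a - rho_of_moment b = secant a b * (a - b).
Proof.
rewrite /rho_of_moment /secant; set S := \sum_(i < _) _.
have h : (1 + a) ^+ m.+1 - (1 + b) ^+ m.+1 = (a - b) * S.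
  by rewrite subrXX; congr (_ * _); ring.
have -> : (1 + b) ^+ m.+1 = (1 + a) ^+ m.+1 - (a - b) * S by rewrite -h; ring.
ring.
Qed.

Lemma secant_ge1 a b : 0 <= a -> 0 <= b -> 1 <= secant a b.
Proof.
move=> a0 b0; rewrite /secant -[leLHS]addr0 lerD//.
  by apply: exprn_ege1; rewrite lerDl.
by apply: mulr_ge0 => //; apply: sumr_ge0 => i _; rewrite mulr_ge0// exprn_ge0// addr_ge0.
Qed.

(** This is the derivative of [rho_of_moment]; its second factor is the source of [gradn]. *)
Lemma secant_diag a : secant a a = (1 + a) ^+ m * (1 + m.+2%:R * a).
Proof.
rewrite /secant (eq_bigr (fun=> (1 + a) ^+ m)) => [|i _]; last first.
  by rewrite -exprD subnK// -ltnS.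
rewrite sumr_const card_ord exprS -[m.+2]addn1 natrD -mulr_natl; ring.
Qed.

Lemma secant_continuous b : continuous (secant ^~ b).
Proof.
move=> a; have hX i : (1 + x) ^+ i @[x --> a] --> (1 + a) ^+ i.
  have h1 : 1 + x @[x --> a] --> 1 + a by apply: cvgD; [exact: cvg_cst|exact: cvg_id].
  elim: i => [|i IHi].
    by rewrite expr0; under eq_fun do rewrite expr0; exact: cvg_cst.
  by rewrite exprS; under eq_fun do rewrite exprS; exact: cvgM.
apply: cvgD; first exact: hX.
apply: cvgM; first exact: cvg_cst.
elim: (index_enum _) => [|i l IHl].
  by under eq_fun do rewrite big_nil; rewrite big_nil; exact: cvg_cst.
under eq_fun do rewrite big_cons; rewrite big_cons; apply: cvgD => //.
by apply: cvgM; [exact: hX|exact: cvg_cst].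
Qed.

Lemma moment_exists r : 0 <= r -> exists2 a, 0 <= a & rho_of_moment a = r.
Proof.
move=> r0; have h : {within `[0, r], continuous rho_of_moment}.
  apply: continuous_subspaceT => x; have := @secant_continuous 0 x.
  move=> sx; have -> : rho_of_moment = fun a => secant a 0 * a.
    apply/funext => a; have := secantE a 0.
    by rewrite subr0 /rho_of_moment mul0r subr0.
  by apply: cvgM; [exact: sx|exact: cvg_id].
(* The interval [0, r] suffices because (1 + r)^(m + 1) >= 1, so the value at r is at least r. *)
have [|a] := @IVT _ _ _ _ r r0 h; last by rewrite in_itv/= => /andP[a0 _] ?; exists a.
have p0 : rho_of_moment 0 = 0 by rewrite /rho_of_moment mul0r.
have pr : r <= rho_of_moment r.
  by rewrite /rho_of_moment ler_peMr// exprn_ege1// lerDl.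
by rewrite p0 ge_min r0/= le_max pr orbT.
Qed.

(** The inverse of [rho_of_moment] on the nonnegative reals; the default 0 is returned only for
    negative [r]. *)
Definition moment r := xget 0 [set a | 0 <= a /\ rho_of_moment a = r].

Lemma momentP r : 0 <= r -> 0 <= moment r /\ rho_of_moment (moment r) = r.
Proof.
move=> /moment_exists[a a0 ar].
by have := @xgetPex _ 0 [set a | 0 <= a /\ rho_of_moment a = r]; apply; exists a.
Qed.

Lemma moment_lipschitz r s : 0 <= r -> 0 <= s ->
  `|moment r - moment s| <= `|r - s|.
Proof.
move=> /momentP[a0 ar] /momentP[b0 bs]; rewrite -{2}ar -{2}bs secantE normrM.
by rewrite ler_peMl// ger0_norm ?secant_ge1// (le_trans ler01) ?secant_ge1.
Qed.

(** In Caratheodory's form: the slope function of the composite is that of [r] divided by the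
    secant, which is at least 1 and continuous in its first argument. *)
Lemma is_derive_moment (r : R -> R) t d : (forall s, 0 <= r s) ->
  is_derive t 1 r d ->
  is_derive t 1 (fun s => moment (r s))
    (d / ((1 + moment (r t)) ^+ m * (1 + m.+2%:R * moment (r t)))).
Proof.
move=> r0 /[dup] dr /is_derive1_caratheodory[g [gE gc gt]].
have Yc : {for t, continuous (fun s => moment (r s))}.
  have rc : {for t, continuous r}.
    by apply/differentiable_continuous/derivable1_diffP; case: dr.
  apply/cvgrPdist_lt => e e0; have /cvgrPdist_lt/(_ e e0) := rc.
  by apply: filterS => s; apply: le_lt_trans; exact: moment_lipschitz.
apply/is_derive1_caratheodory.
exists (fun z => g z / secant (moment (r z)) (moment (r t))).
have q0 z : secant (moment (r z)) (moment (r t)) != 0.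
  have [a0 _] := momentP (r0 z); have [b0 _] := momentP (r0 t).
  by rewrite gt_eqF// (lt_le_trans ltr01)// secant_ge1.
split=> [z||]; last by rewrite secant_diag gt.
  have [_ az] := momentP (r0 z); have [_ bt] := momentP (r0 t).
  have := secantE (moment (r z)) (moment (r t)); rewrite az bt gE => h.
  by apply: (mulfI (q0 z)); rewrite -h; field; exact: q0.
apply: cvgM; first exact: gc.
apply: cvgV; first exact: q0.
exact: (continuous_comp Yc (@secant_continuous (moment (r t)) (moment (r t)))).
Qed.

End Moment.

(** * The functions entering the metric and their first derivatives *)

Section MetricFunctions.
Variables (R : realType) (m : nat).
Local Notation C := (R[i]).
Local Notation V := ('rV[C]_2).
Local Notation K := (R[i] : numFieldType).
Local Notation VN := ('rV[R[i]]_2 : normedModType R[i]).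
Local Notation kk := (m.+1%:R : C).
Implicit Types (u v w x : V).

(* Here k = m + 1. Over the point with coordinates [x] (after rescaling the fibre
   coordinate), the level set |a|^2 + |b|^2 - k |w|^2 = 1 has k |w|^2 = [Y x], and
   [gradn x] is the squared norm of half the gradient of the moment map there. *)
Definition zc x := x 0 0.
Definition uc x := x 0 1.
Definition bnorm x := 1 + zc x * (zc x)^*%C.
Definition rho x := uc x * (uc x)^*%C * bnorm x ^+ m.+1.
Definition Yr x : R := moment m (Re (rho x)).
Definition Y x : C := (Yr x)%:C%C.
Definition gradn x := 1 + m.+2%:R * Y x.
(** This is the derivative of Y with respect to |u|^2: the derivative of [rho], divided by that of
    [rho_of_moment] at Y. *)
Definition fcoef x := bnorm x ^+ m.+1 * ((1 + Y x) ^+ m * gradn x)^-1.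

Lemma bnorm_gt0 x : 0 < bnorm x.
Proof. by rewrite /bnorm ltr_wpDr// mulcJ_ge0. Qed.

Lemma bnorm_neq0 x : bnorm x != 0.
Proof. by rewrite gt_eqF// bnorm_gt0. Qed.

Lemma rho_ge0 x : 0 <= rho x.
Proof. by rewrite /rho mulr_ge0 ?mulcJ_ge0// exprn_ge0// ltW// bnorm_gt0. Qed.

Lemma Re_rho_ge0 x : 0 <= Re (rho x).
Proof. by have := rho_ge0 x; rewrite lecE => /andP[]. Qed.

Lemma Re_rhoK x : (Re (rho x))%:C%C = rho x.
Proof. by have := ger0_Im (rho_ge0 x); case: (rho x) => a b /= ->. Qed.

Lemma Yr_ge0 x : 0 <= Yr x.
Proof. by have [] := momentP m (Re_rho_ge0 x). Qed.

Lemma Y_ge0 x : 0 <= Y x.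
Proof. by rewrite /Y ler0c Yr_ge0. Qed.

Lemma Y_rho x : Y x * (1 + Y x) ^+ m.+1 = rho x.
Proof.
have [_ h] := momentP m (Re_rho_ge0 x).
by rewrite -[RHS]Re_rhoK -h /rho_of_moment rmorphM rmorphXn rmorphD rmorph1.
Qed.

Lemma Y1_gt0 x : 0 < 1 + Y x.
Proof. by rewrite ltr_wpDr// Y_ge0. Qed.

Lemma Y1_neq0 x : 1 + Y x != 0.
Proof. by rewrite gt_eqF// Y1_gt0. Qed.

Lemma gradn_gt0 x : 0 < gradn x.
Proof. by rewrite ltr_wpDr// mulr_ge0// Y_ge0. Qed.

Lemma gradn_neq0 x : gradn x != 0.
Proof. by rewrite gt_eqF// gradn_gt0. Qed.

Lemma fcoef_gt0 x : 0 < fcoef x.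
Proof.
by rewrite /fcoef divr_gt0 ?exprn_gt0 ?bnorm_gt0// mulr_gt0 ?exprn_gt0 ?Y1_gt0 ?gradn_gt0.
Qed.

Lemma fcoef_neq0 x : fcoef x != 0.
Proof. by rewrite gt_eqF// fcoef_gt0. Qed.

Lemma smooth_bnorm : smooth bnorm.
Proof.
apply: smoothD; first exact: smooth_cst.
by apply: smoothM; [exact: smooth_coord|apply: smoothJ; exact: smooth_coord].
Qed.

Lemma smooth_rho : smooth rho.
Proof.
apply: smoothM; last by apply: smoothX; exact: smooth_bnorm.
by apply: smoothM; [exact: smooth_coord|apply: smoothJ; exact: smooth_coord].
Qed.

Lemma has_diff_Y : has_diff Y
  (fun j x => dz j rho x * ((1 + Y x) ^+ m * gradn x)^-1)
  (fun j x => dzbar j rho x * ((1 + Y x) ^+ m * gradn x)^-1).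
Proof.
move=> c t w h; have /(_ _ _ _ h)[h1 h2] := smooth_diff smooth_rho.
set d := \sum_j _ in h1 h2.
(* [rho] takes real values, so its derivative along a curve is real and nothing is lost by passing
   to [moment] of the real part. *)
have imd : Im d = 0.
  rewrite -(@derive_val _ _ _ _ _ _ _ h2).
  under eq_fun do rewrite (ger0_Im (rho_ge0 _)).
  exact: derive_cst.
have -> : \sum_j (dz j rho (c t) * ((1 + Y (c t)) ^+ m * gradn (c t))^-1 * w 0 j +
     dzbar j rho (c t) * ((1 + Y (c t)) ^+ m * gradn (c t))^-1 * (w 0 j)^*%C) =
    (Re d / ((1 + Yr (c t)) ^+ m * (1 + m.+2%:R * Yr (c t))))%:C%C.
  have E (a b : R) : (a / ((1 + b) ^+ m * (1 + m.+2%:R * b)))%:C%C =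
      a%:C%C / ((1 + b%:C%C) ^+ m * (1 + m.+2%:R * b%:C%C)).
    by rewrite rmorphM fmorphV rmorphM rmorphXn !rmorphD rmorph1 rmorphM rmorph_nat.
  rewrite E -/(Y (c t)) -/(gradn (c t)).
  have -> : (Re d)%:C%C = d by case: (d) imd => a b /= ->.
  rewrite /d mulr_suml; apply: eq_bigr => j _.
  by rewrite mulrDl; congr (_ + _); rewrite mulrAC.
apply: cder_real; apply: is_derive_moment h1 => s; exact: Re_rho_ge0.
Qed.

Lemma Yr_continuous : continuous (Yr : VN -> R).
Proof.
move=> x A /nbhs_normP[e e0 eA].
have h : nbhs (Re (rho x)) [set r | `|Re (rho x) - r| < e].
  by apply/nbhs_normP; exists e.
have := smooth_Re_continuous smooth_rho h.
apply: (@filterS _ (nbhs (x : VN))) => y /= xy.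
apply: eA; apply: le_lt_trans xy.
by apply: moment_lipschitz; exact: Re_rho_ge0.
Qed.

Lemma real_complex_continuous : continuous ((fun r : R => r%:C%C) : R -> K).
Proof.
move=> r A /nbhs_normP[e e0 eA].
have eE : e = (Re e)%:C%C by rewrite RRe_real// gtr0_real.
have e1 : 0 < Re e by rewrite -ltcR -eE.
apply/nbhs_normP; exists (Re e) => //= s rs; apply: eA => /=.
by rewrite -rmorphB normc_def/= expr0n addr0 sqrtr_sqr eE ltcR.
Qed.

Lemma Y_continuous : continuous (Y : VN -> K).
Proof.
move=> x.
exact (@continuous_comp VN R K Yr _ x (@Yr_continuous x)
  (@real_complex_continuous (Yr x))).
Qed.

(** The bootstrap: the partials of Y are those of [rho] times a rational function of Y with nowhere
    vanishing denominator, so order s for Y gives order s + 1. *)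
Lemma smooth_Y : smooth Y.
Proof.
elim=> [|s IHs]; (split; first exact: Y_continuous);
  do 2 eexists; (split; first exact: has_diff_Y) => //.
have sN : smooth_upto s (fun x => ((1 + Y x) ^+ m * gradn x)^-1).
  apply: smooth_uptoV.
    by move=> x; rewrite mulf_neq0 ?expf_neq0 ?Y1_neq0 ?gradn_neq0.
  have s1 : smooth_upto s (fun x => 1 + Y x).
    by apply: smooth_uptoD => //; exact: smooth_upto_cst.
  apply: smooth_uptoM.
    elim: m => [|l IHl]; first by under eq_fun do rewrite expr0; exact: smooth_upto_cst.
    by under eq_fun do rewrite exprS; exact: smooth_uptoM.
  apply: smooth_uptoD; first exact: smooth_upto_cst.
  by apply: smooth_uptoM => //; exact: smooth_upto_cst.
move=> j; split; apply: smooth_uptoM => //.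
  exact: (smooth_dz _ smooth_rho).
exact: (smooth_dzbar _ smooth_rho).
Qed.

(* The coframe dz / (1 + |z|^2), du + k u zbar dz / (1 + |z|^2), evaluated at the
   tangent vector [v]: it diagonalizes the metric. *)
Definition horiz v x := v 0 0 / bnorm x.
Definition vert v x := v 0 1 + kk * uc x * (zc x)^*%C * v 0 0 / bnorm x.

Lemma bnorm_conj x : (bnorm x)^*%C = bnorm x.
Proof. by rewrite /bnorm conjcD conjc1 conjcM conjcK mulrC. Qed.

Lemma Y_conj x : (Y x)^*%C = Y x.
Proof. exact: conjc_real. Qed.

Lemma gradn_conj x : (gradn x)^*%C = gradn x.
Proof. by rewrite /gradn conjcD conjc1 conjcM conjc_nat Y_conj. Qed.

Lemma fcoef_conj x : (fcoef x)^*%C = fcoef x.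
Proof.
by rewrite /fcoef conjcM conjcX bnorm_conj conjc_inv conjcM gradn_conj
  conjcX conjcD conjc1 Y_conj.
Qed.

(* [bf] comes from the logarithmic derivative of 1 / ((1 + Y) ^ m N) with respect
   to [Y], and [b2f] is its derivative. *)
Definition bf x := - (m%:R / (1 + Y x) + m.+2%:R / gradn x).
Definition b2f x := m%:R / (1 + Y x) ^+ 2 + m.+2%:R ^+ 2 / gradn x ^+ 2.

Lemma has_del_z u x : has_del u zc x (u 0 0) 0.
Proof. exact: has_del_coord. Qed.
Lemma has_del_u u x : has_del u uc x (u 0 1) 0.
Proof. exact: has_del_coord. Qed.
Lemma has_del_zJ u x : has_del u (fun y => (zc y)^*%C) x 0 (u 0 0)^*%C.
Proof. by apply: has_del_eq (has_delJ (has_del_z _ _)) _ _; rewrite ?conjc0. Qed.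
Lemma has_del_uJ u x : has_del u (fun y => (uc y)^*%C) x 0 (u 0 1)^*%C.
Proof. by apply: has_del_eq (has_delJ (has_del_u _ _)) _ _; rewrite ?conjc0. Qed.

Lemma has_del_bnorm u x : has_del u bnorm x ((zc x)^*%C * u 0 0) (zc x * (u 0 0)^*%C).
Proof.
have h := has_delD (has_del_cst _ _ 1) (has_delM (has_del_z u x) (has_del_zJ u x)).
by apply: has_del_eq h _ _; ring.
Qed.

(** The form [vert] is what makes the (1,0)-derivative of [rho] a single term, ubar [bnorm]^k
    [vert]: it is the covariant differential of u for the fibre metric [bnorm]^k. *)
Lemma has_del_Y u x : has_del u Y x (fcoef x * (uc x)^*%C * vert u x)
  (fcoef x * uc x * (vert u x)^*%C).
Proof.
have h : has_del u rho x ((uc x)^*%C * bnorm x ^+ m.+1 * vert u x)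
    (uc x * bnorm x ^+ m.+1 * (vert u x)^*%C).
  have hp := has_delM (has_delM (has_del_u u x) (has_del_uJ _ _))
    (has_delX m (has_del_bnorm _ _)).
  apply: has_del_eq hp _ _; rewrite ?/vert ?exprS.
    by field; exact: bnorm_neq0.
  rewrite conjcD !conjcM conjcK conjc_nat conjc_inv bnorm_conj.
  by field; exact: bnorm_neq0.
have [_ h1 h2] := h; have := has_del_of u x smooth_Y has_diff_Y.
move/has_del_eq; apply.
  transitivity (del u rho x * ((1 + Y x) ^+ m * gradn x)^-1).
    by rewrite /del mulr_suml; apply: eq_bigr => j _; ring.
  by rewrite h1 /fcoef; ring.
transitivity (delbar u rho x * ((1 + Y x) ^+ m * gradn x)^-1).
  by rewrite /delbar mulr_suml; apply: eq_bigr => j _; ring.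
by rewrite h2 /fcoef; ring.
Qed.

Lemma has_del_Y1 u x : has_del u (fun y => 1 + Y y) x (fcoef x * (uc x)^*%C * vert u x)
  (fcoef x * uc x * (vert u x)^*%C).
Proof.
by apply: has_del_eq (has_delD (has_del_cst _ _ _) (has_del_Y _ _)) _ _; rewrite add0r.
Qed.

Lemma has_del_N u x : has_del u gradn x (m.+2%:R * (fcoef x * (uc x)^*%C * vert u x))
  (m.+2%:R * (fcoef x * uc x * (vert u x)^*%C)).
Proof.
have h := has_delD (has_del_cst _ _ 1) (has_delZ m.+2%:R (has_del_Y u x)).
by apply: has_del_eq h _ _; rewrite add0r.
Qed.

Lemma vert_conj u x : (vert u x)^*%C =
  (u 0 1)^*%C + kk * (uc x)^*%C * zc x * (u 0 0)^*%C / bnorm x.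
Proof. by rewrite /vert conjcD !conjcM conjcK conjc_nat conjc_inv bnorm_conj. Qed.

Lemma horiz_conj u x : (horiz u x)^*%C = (u 0 0)^*%C / bnorm x.
Proof. by rewrite /horiz conjcM conjc_inv bnorm_conj. Qed.

(** Arranged as [fcoef] times a logarithmic derivative: the term in [bf] comes from the denominator,
    a function of Y, and the term in [kk] from [bnorm]^k. *)
Lemma has_del_F u x : has_del u fcoef x
  (fcoef x * (bf x * fcoef x * (uc x)^*%C * vert u x + kk * (zc x)^*%C * horiz u x))
  (fcoef x * (bf x * fcoef x * uc x * (vert u x)^*%C + kk * zc x * (horiz u x)^*%C)).
Proof.
have N0 : forall y, (1 + Y y) ^+ m * gradn y != 0.
  by move=> y; rewrite mulf_neq0 ?expf_neq0 ?Y1_neq0 ?gradn_neq0.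
have hX : has_del u (fun y => (1 + Y y) ^+ m) x
    (m%:R * (1 + Y x) ^+ m / (1 + Y x) * (fcoef x * (uc x)^*%C * vert u x))
    (m%:R * (1 + Y x) ^+ m / (1 + Y x) * (fcoef x * uc x * (vert u x)^*%C)).
  (* The power rule is stated for successor exponents; for m = 0 the function is constant and the
     factor m kills the claimed derivative. *)
  case: (m) (has_del_Y1 u x) => [|l] hY.
    by under eq_fun do rewrite expr0; apply: has_del_eq (has_del_cst _ _ _) _ _;
      rewrite !mul0r.
  by apply: has_del_eq (has_delX l hY) _ _; rewrite exprSr; field; exact: Y1_neq0.
have h := has_delM (has_delX m (has_del_bnorm u x))
  (has_delV N0 (has_delM hX (has_del_N u x))).
apply: has_del_eq h _ _.
  rewrite /bf /horiz /fcoef exprS; set E := bnorm x ^+ m; set A := (1 + Y x) ^+ m.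
  have A0 : A != 0 by rewrite expf_neq0 ?Y1_neq0.
  have := bnorm_neq0 x; have := Y1_neq0 x; have := gradn_neq0 x.
  move: (bnorm x) (Y x) (gradn x) (vert u x) => D y N t *.
  by field; do ?[apply/andP; split].
rewrite horiz_conj /bf /fcoef exprS; set E := bnorm x ^+ m; set A := (1 + Y x) ^+ m.
have A0 : A != 0 by rewrite expf_neq0 ?Y1_neq0.
have := bnorm_neq0 x; have := Y1_neq0 x; have := gradn_neq0 x.
move: (bnorm x) (Y x) (gradn x) (vert u x)^*%C => D y N t *.
by field; do ?[apply/andP; split].
Qed.

Lemma has_del_b u x : has_del u bf x (b2f x * (fcoef x * (uc x)^*%C * vert u x))
  (b2f x * (fcoef x * uc x * (vert u x)^*%C)).
Proof.
have h := has_delN (has_delD (has_delZ m%:R (has_delV Y1_neq0 (has_del_Y1 u x)))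
  (has_delZ m.+2%:R (has_delV gradn_neq0 (has_del_N u x)))).
by apply: has_del_eq h _ _; rewrite /b2f; field; rewrite Y1_neq0 gradn_neq0.
Qed.

Lemma has_del_horiz u v x : has_del u (horiz v) x (- ((zc x)^*%C * horiz u x * horiz v x))
  (- (zc x * (horiz u x)^*%C * horiz v x)).
Proof.
have h := has_delZ (v 0 0) (has_delV bnorm_neq0 (has_del_bnorm u x)).
by apply: has_del_eq h _ _; rewrite ?horiz_conj /horiz; field; exact: bnorm_neq0.
Qed.

(** The antiholomorphic derivative carries the curvature of O(-k), from d/dzbar (zbar / (1 + |z|^2))
    = 1 / (1 + |z|^2)^2. *)
Lemma has_del_vert u v x : has_del u (vert v) x
  (kk * (zc x)^*%C * horiz v x * (vert u x - m.+2%:R * uc x * (zc x)^*%C * horiz u x))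
  (kk * uc x * horiz v x * (horiz u x)^*%C).
Proof.
have h := has_delD (has_del_cst u x (v 0 1))
  (has_delM (has_delM (has_delM (has_delZ kk (has_del_u u x)) (has_del_zJ _ _))
    (has_del_cst _ _ (v 0 0))) (has_delV bnorm_neq0 (has_del_bnorm u x))).
apply: has_del_eq h _ _; rewrite ?horiz_conj /vert /horiz.
  by rewrite -[m.+2]addn1 natrD; field; exact: bnorm_neq0.
have D0 := bnorm_neq0 x; have zE : zc x * (zc x)^*%C = bnorm x - 1 by rewrite /bnorm; ring.
(* [field] treats [bnorm x] as an atom, so the relation [bnorm] - |z|^2 = 1 has to be isolated and
   applied by hand. *)
transitivity (kk * uc x * v 0 0 * (u 0 0)^*%C *
  (bnorm x - zc x * (zc x)^*%C) / bnorm x ^+ 2).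
  by field.
by rewrite zE; field.
Qed.

End MetricFunctions.

(** * Curvature of the quotient metric *)

Section CurvatureSum.
Variables (R : realType) (n : nat).
Local Notation C := (R[i]).
Local Notation V := ('rV[C]_n).
Implicit Types (F G : V -> C) (u v x : V) (l : C).

Lemma has_del_sum (I : Type) (r : seq I) (F : I -> V -> C) u x p q :
  (forall i, has_del u (F i) x (p i) (q i)) ->
  has_del u (fun y => \sum_(i <- r) F i y) x
    (\sum_(i <- r) p i) (\sum_(i <- r) q i).
Proof.
move=> h; elim: r => [|i r IHr].
  by rewrite !big_nil; under eq_fun do rewrite big_nil; exact: has_del_cst.
by rewrite !big_cons; under eq_fun do rewrite big_cons; exact: has_delD.
Qed.

Lemma has_delZr F u x p q l : has_del u F x p q ->
  has_del u (fun y => F y * l) x (p * l) (q * l).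
Proof.
by move=> h; apply: has_del_eq (has_delM h (has_del_cst _ _ _)) _ _; rewrite mulr0 addr0.
Qed.

Lemma has_del_hform (g : V -> 'M[C]_n) (u v w x : V) :
  (forall a b, smooth (fun y => g y a b)) ->
  has_del u (fun y => hform (g y) v w) x
    (\sum_a \sum_b \sum_c dz c (fun y => g y a b) x * u 0 c * v 0 a * (w 0 b)^*%C)
    (\sum_a \sum_b \sum_d
      dzbar d (fun y => g y a b) x * (u 0 d)^*%C * v 0 a * (w 0 b)^*%C).
Proof.
move=> sg; apply: has_del_sum => a; apply: has_del_sum => b.
have := has_delZr (w 0 b)^*%C (has_delZr (v 0 a) (has_del_self u x (sg a b))).
move/has_del_eq; apply; rewrite ?/del ?/delbar -mulrA mulr_suml;
  by apply: eq_bigr => c _; rewrite mulrA.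
Qed.

Lemma hform_deltar (g : 'M[C]_n) v a :
  hform g v (delta_mx 0 a) = \sum_b g b a * v 0 b.
Proof.
apply: eq_bigr => b _; rewrite (bigD1 a)//= big1 => [|c /negPf ca].
  by rewrite !mxE !eqxx addr0 conjc1 mulr1.
by rewrite !mxE ca andbF conjc0 mulr0.
Qed.

Lemma hform_deltal (g : 'M[C]_n) v a :
  hform g (delta_mx 0 a) v = \sum_b g a b * (v 0 b)^*%C.
Proof.
rewrite /hform (bigD1 a)//= [X in _ + X]big1 => [|c /negPf ca].
  by rewrite addr0; apply: eq_bigr => b _; rewrite !mxE !eqxx mulr1.
by rewrite big1// => b _; rewrite !mxE ca andbF mulr0 mul0r.
Qed.

(** As [v] has constant coordinates, the contractions commute with the derivatives. The four-index
    sum becomes a second derivative of the scalar g(v, v) plus a term quadratic in the first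
    derivatives of g(v, .). *)
Lemma curvature_sum (M : cmanifold R[i] n) (g : hermitian_metric M)
    (i : chart M) (v x : V) :
  (forall a b, smooth (fun y => g i y a b)) ->
  \sum_a \sum_b \sum_c \sum_d curvature g i x a b c d *
     v 0 a * (v 0 b)^*%C * v 0 c * (v 0 d)^*%C =
  - del v (delbar v (fun y => hform (g i y) v v)) x +
  \sum_p \sum_q invmx (g i x) p q *
    del v (fun y => hform (g i y) v (delta_mx 0 p)) x *
    delbar v (fun y => hform (g i y) (delta_mx 0 q) v) x.
Proof.
move=> sg; set S := (X in _ = _ + X).
have exch (f : 'I_n -> 'I_n -> 'I_n -> C) :
    \sum_i \sum_p \sum_q f i p q = \sum_p \sum_q \sum_i f i p q.
  by rewrite exchange_big; apply: eq_bigr => p _; rewrite exchange_big.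
have -> : delbar v (fun y => hform (g i y) v v) = fun y =>
    \sum_a \sum_b \sum_d
      dzbar d (fun y => g i y a b) y * ((v 0 d)^*%C * v 0 a * (v 0 b)^*%C).
  apply/funext => y; have [_ _ ->] := has_del_hform v v v y sg.
  by do 3 (apply: eq_bigr => ? _); rewrite !mulrA.
have -> : del v (fun y => \sum_a \sum_b \sum_d dzbar d (fun y => g i y a b) y *
      ((v 0 d)^*%C * v 0 a * (v 0 b)^*%C)) x =
    \sum_a \sum_b \sum_d del v (dzbar d (fun y => g i y a b)) x *
      ((v 0 d)^*%C * v 0 a * (v 0 b)^*%C).
  have h := has_del_sum (index_enum _) (fun a => has_del_sum (index_enum _) (fun b =>
    has_del_sum (index_enum _) (fun d => has_delZr ((v 0 d)^*%C * v 0 a * (v 0 b)^*%C)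
      (has_del_self v x (smooth_dzbar d (sg a b)))))).
  by have [_ -> _] := h.
have -> : S = \sum_a \sum_b \sum_c \sum_d (\sum_p \sum_q invmx (g i x) p q *
    dz c (fun y => g i y a p) x * dzbar d (fun y => g i y q b) x) *
    (v 0 a * (v 0 b)^*%C * v 0 c * (v 0 d)^*%C).
  rewrite /S.
  transitivity (\sum_p \sum_q \sum_a \sum_b \sum_c \sum_d invmx (g i x) p q *
    dz c (fun y => g i y a p) x * dzbar d (fun y => g i y q b) x *
    (v 0 a * (v 0 b)^*%C * v 0 c * (v 0 d)^*%C)).
    apply: eq_bigr => p _; apply: eq_bigr => q _.
    have -> : del v (fun y => hform (g i y) v (delta_mx 0 p)) x =
        \sum_a \sum_c dz c (fun y => g i y a p) x * v 0 c * v 0 a.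
      have -> : (fun y => hform (g i y) v (delta_mx 0 p)) =
          fun y => \sum_b g i y b p * v 0 b.
        by apply/funext => y; rewrite hform_deltar.
      have [_ -> _] := has_del_sum (index_enum _)
        (fun b => has_delZr (v 0 b) (has_del_self v x (sg b p))).
      by apply: eq_bigr => b _; rewrite mulr_suml.
    have -> : delbar v (fun y => hform (g i y) (delta_mx 0 q) v) x =
        \sum_b \sum_d dzbar d (fun y => g i y q b) x * (v 0 d)^*%C * (v 0 b)^*%C.
      have -> : (fun y => hform (g i y) (delta_mx 0 q) v) =
          fun y => \sum_b g i y q b * (v 0 b)^*%C.
        by apply/funext => y; rewrite hform_deltal.
      have [_ _ ->] := has_del_sum (index_enum _)
        (fun b => has_delZr (v 0 b)^*%C (has_del_self v x (sg q b))).
      by apply: eq_bigr => b _; rewrite mulr_suml.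
    rewrite -mulrA mulr_suml mulr_sumr; apply: eq_bigr => a _.
    rewrite mulr_sumr mulr_sumr; apply: eq_bigr => b _.
    rewrite mulr_suml mulr_sumr; apply: eq_bigr => c _.
    rewrite mulr_sumr mulr_sumr; apply: eq_bigr => d _.
    by set A := dz _ _ _; set B := dzbar _ _ _; ring.
  rewrite -exch; apply: eq_bigr => a _; rewrite -exch; apply: eq_bigr => b _.
  rewrite -exch; apply: eq_bigr => c _; rewrite -exch; apply: eq_bigr => d _.
  by rewrite mulr_suml; apply: eq_bigr => p _; rewrite mulr_suml.
rewrite -sumrN -big_split; apply: eq_bigr => a _.
rewrite -sumrN -big_split; apply: eq_bigr => b _ /=.
have -> : \sum_d del v (dzbar d (fun y => g i y a b)) x *
      ((v 0 d)^*%C * v 0 a * (v 0 b)^*%C) =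
    \sum_c \sum_d dz c (dzbar d (fun y => g i y a b)) x * v 0 c *
      ((v 0 d)^*%C * v 0 a * (v 0 b)^*%C).
  by rewrite exchange_big; apply: eq_bigr => d _; rewrite /del mulr_suml.
rewrite -sumrN -big_split; apply: eq_bigr => c _ /=.
rewrite -sumrN -big_split; apply: eq_bigr => d _ /=.
rewrite /curvature; set A := dz _ _ _; set B := \sum_p _.
by rewrite mulrDl mulNr !mulrDl !mulNr; congr (- _ + _);
  rewrite -!mulrA; congr (_ * _); ring.
Qed.

End CurvatureSum.

(* [second_deriv_value] is the value of the second derivative of the metric form
   along [v], [v bar] on [v], [v bar], as a function of the coordinates
   [z, w = z bar, u, s = u bar], of [a = horiz v], [vert = vert v] and of their
   conjugates [ab], [thb]. *)
Definition second_deriv_value (K : fieldType)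
    (k z w u s a ab vert thb y F b b2 v0 v1 : K) : K :=
  let dY := F * s * vert in
  let dF := F * (b * F * s * vert + k * w * a) in
  let dth := k * w * a * (vert - (k + 1) * u * w * a) in
  2 * k * (dF * u * a * thb * ab + F * v1 * a * thb * ab
    - F * u * (w * a ^+ 2) * thb * ab + F * u * a * (k * s * a * ab) * ab
    - F * u * a * thb * (w * a * ab))
  - 2 * k * (dY * z * ab ^+ 2 * a + (1 + y) * v0 * ab ^+ 2 * a
    - (1 + y) * z * 2 * ab * (w * a * ab) * a
    - (1 + y) * z * ab ^+ 2 * (w * a ^+ 2))
  + (dF * vert + F * dth) * (b * F * u * thb ^+ 2 + 2 * k * z * ab * thb
    - k * (k + 1) * s * z ^+ 2 * ab ^+ 2)
  + F * vert * (b2 * dY * F * u * thb ^+ 2 + b * dF * u * thb ^+ 2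
    + b * F * v1 * thb ^+ 2 + b * F * u * 2 * thb * (k * s * a * ab)
    + 2 * k * v0 * ab * thb - 2 * k * z * (w * a * ab) * thb
    + 2 * k * z * ab * (k * s * a * ab)
    - k * (k + 1) * s * (2 * z * v0 * ab ^+ 2
      - z ^+ 2 * 2 * ab * (w * a * ab))).

(* The left-hand side is the numerator of the holomorphic sectional curvature:
   [c1] and [c2] are the components, in the coframe [horiz], [vert], of the first
   derivative of the metric along [v] paired with [v]. *)
Lemma curvature_square (K : fieldType) (k z w u s a ab vert thb y F v0 v1 : K) :
  let N := 1 + (k + 1) * y in
  let b := - ((k - 1) / (1 + y) + (k + 1) / N) in
  let b2 := (k - 1) / (1 + y) ^+ 2 + (k + 1) ^+ 2 / N ^+ 2 in
  let c1 := 2 * k * a * (F * s * vert - (1 + y) * w * a) in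
  let c1b := 2 * k * ab * (F * u * thb - (1 + y) * z * ab) in
  let c2 := F * (b * F * s * vert ^+ 2 + 2 * k * w * a * vert
    - k * (k + 1) * u * w ^+ 2 * a ^+ 2) in
  let c2b := F * (b * F * u * thb ^+ 2 + 2 * k * z * ab * thb
    - k * (k + 1) * s * z ^+ 2 * ab ^+ 2) in
  v0 = a * (1 + z * w) -> v1 = vert - k * u * w * a ->
  F * (u * s) * N = y * (1 + y) -> (u == 0) = (s == 0) ->
  F != 0 -> 1 + y != 0 -> N != 0 -> k != 0 ->
  - second_deriv_value k z w u s a ab vert thb y F b b2 v0 v1
    + (c1 * c1b / (k * (1 + y)) + c2 * c2b / F) =
  2 * k / N * ((1 + y) * (a * ab) - F * (vert * thb) / N) ^+ 2.
Proof.
move=> N b b2 c1 c1b c2 c2b v0E v1E Fus us0 F0 y0 N0 k0.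
rewrite /second_deriv_value.
(* Off the zero section the moment relation eliminates [F]. On it the relation says only that y = 0,
   and the identity holds with [F] free. *)
have [u0|u0] := eqVneq u 0.
  have s0 : s = 0 by apply/eqP; rewrite -us0 u0.
  have yz : y = 0 by apply: (mulIf y0); rewrite mul0r -Fus u0 mul0r mulr0 mul0r.
  rewrite /c1 /c1b /c2 /c2b /b2 /b /N v0E v1E u0 s0 yz.
  by field; rewrite oner_eq0 F0 k0.
have s0 : s != 0 by rewrite -us0.
have FE : F = y * (1 + y) / (N * (u * s)).
  by rewrite -Fus; field; rewrite N0 u0 s0.
have yz : y != 0 by apply: contra_neq F0 => yz; rewrite FE yz !mul0r.
rewrite /c1 /c1b /c2 /c2b /b2 /b v0E v1E FE.
rewrite /N in N0 *.
by field; rewrite k0 yz u0 s0 y0 N0.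
Qed.

(** * The metric form and its derivatives *)

Section MetricTensor.
Variables (R : realType) (m : nat).
Local Notation C := (R[i]).
Local Notation V := ('rV[C]_2).
Local Notation kk := (m.+1%:R : C).
Local Notation Y := (@Y R m).
Local Notation gradn := (@gradn R m).
Local Notation fcoef := (@fcoef R m).
Local Notation vert := (@vert R m).
Local Notation bf := (@bf R m).
Local Notation b2f := (@b2f R m).
Local Notation horiz := (@horiz R).
Local Notation zc := (@zc R).
Local Notation uc := (@uc R).
Implicit Types (u v w x : V).

(** This is k times the quotient metric in the rescaled coordinate u. The first term is the
    Fubini-Study metric scaled by the squared radius |a|^2 + |b|^2 = 1 + Y. *)
Definition gform v w x := kk * (1 + Y x) * horiz v x * (horiz w x)^*%C
  + fcoef x * vert v x * (vert w x)^*%C.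

Definition dgform u v w x :=
  kk * fcoef x * (uc x)^*%C * (horiz w x)^*%C *
    (vert u x * horiz v x + vert v x * horiz u x)
  - 2 * kk * (1 + Y x) * (zc x)^*%C * horiz u x * horiz v x * (horiz w x)^*%C
  + fcoef x * (vert w x)^*%C * (bf x * fcoef x * (uc x)^*%C * vert u x * vert v x
      + kk * (zc x)^*%C * (horiz v x * vert u x + horiz u x * vert v x)
      - kk * m.+2%:R * uc x * (zc x)^*%C ^+ 2 * horiz u x * horiz v x).

(** Symmetry of the holomorphic derivative of the metric in its two holomorphic slots is the Kahler
    condition. *)
Lemma TfC u v w x : dgform u v w x = dgform v u w x.
Proof. by rewrite /dgform; ring. Qed.

Lemma has_del_avJ u v x : has_del u (fun y => (horiz v y)^*%C) x
  (- ((zc x)^*%C * horiz u x * (horiz v x)^*%C))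
  (- (zc x * (horiz u x)^*%C * (horiz v x)^*%C)).
Proof.
apply: has_del_eq (has_delJ (has_del_horiz _ _ _)) _ _;
  move: (zc x) (horiz u x) (horiz v x) => z a b; by rewrite conjcN !conjcM ?conjcK.
Qed.

Lemma has_del_thJ u v x : has_del u (fun y => (vert v y)^*%C) x
  (kk * (uc x)^*%C * horiz u x * (horiz v x)^*%C)
  (kk * zc x * (horiz v x)^*%C *
    ((vert u x)^*%C - m.+2%:R * (uc x)^*%C * zc x * (horiz u x)^*%C)).
Proof.
apply: has_del_eq (has_delJ (has_del_vert _ _ _ _)) _ _;
  move: (zc x) (uc x) (horiz u x) (horiz v x) (vert u x) => z t a b e.
  by rewrite !conjcM conjcK conjc_nat; ring.
by rewrite !conjcM conjcB !conjcM conjcK !conjc_nat; ring.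
Qed.

Lemma gform_conj v w x : (gform v w x)^*%C = gform w v x.
Proof.
rewrite /gform conjcD; have := Y_conj m x; have := fcoef_conj m x.
move: (fcoef x) (Y x) (horiz v x) (horiz w x) (vert v x) (vert w x) => F y a b t s FJ yJ.
by rewrite !conjcM !conjcK conjcD conjc1 conjc_nat FJ yJ; ring.
Qed.

Lemma has_del_gform u v w x :
  has_del u (gform v w) x (dgform u v w x) (dgform u w v x)^*%C.
Proof.
have hT v' w' : del u (gform v' w') x = dgform u v' w' x /\ smooth (gform v' w').
  have h := has_delD
    (has_delM (has_delM (has_delZ kk (has_del_Y1 m u x)) (has_del_horiz u v' x))
      (has_del_avJ u w' x))
    (has_delM (has_delM (has_del_F m u x) (has_del_vert m u v' x)) (has_del_thJ u w' x)).
  have [sG hp _] := h; split=> //.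
  rewrite [LHS]hp /dgform.
  move: (fcoef x) (Y x) (horiz u x) (horiz v' x) (horiz w' x)^*%C (vert u x) (vert v' x).
  move: (vert w' x)^*%C (bf x) (uc x)^*%C (zc x)^*%C (uc x) => *.
  ring.
(* Hermitian symmetry yields the antiholomorphic derivative by conjugation, without a second
   computation. *)
have [h1 sG] := hT v w; have [h2 sG'] := hT w v.
split=> //; have [_ _] := has_delJ (has_del_self u x sG').
by under eq_fun do rewrite gform_conj; rewrite h2.
Qed.

Lemma bf_conj x : (bf x)^*%C = bf x.
Proof.
rewrite /bf; have := Y_conj m x; have := gradn_conj m x.
move: (Y x) (gradn x) => y N NJ yJ.
by rewrite conjcN conjcD !conjcM !conjc_inv conjcD conjc1 !conjc_nat NJ yJ.
Qed.

(** The antiholomorphic derivative of g(v, v), kept as a function of the point so that it can be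
    differentiated once more. *)
Definition dgform_bar v x :=
  2 * kk * (fcoef x * uc x * horiz v x * (vert v x)^*%C * (horiz v x)^*%C)
  - 2 * kk * ((1 + Y x) * zc x * (horiz v x)^*%C ^+ 2 * horiz v x)
  + fcoef x * vert v x * (bf x * fcoef x * uc x * (vert v x)^*%C ^+ 2
      + 2 * kk * zc x * (horiz v x)^*%C * (vert v x)^*%C
      - kk * m.+2%:R * (uc x)^*%C * zc x ^+ 2 * (horiz v x)^*%C ^+ 2).

Lemma dgform_conj v w x : (dgform v v w x)^*%C =
  2 * kk * (fcoef x * uc x * horiz w x * (vert v x)^*%C * (horiz v x)^*%C)
  - 2 * kk * ((1 + Y x) * zc x * (horiz v x)^*%C ^+ 2 * horiz w x)
  + fcoef x * vert w x * (bf x * fcoef x * uc x * (vert v x)^*%C ^+ 2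
      + 2 * kk * zc x * (horiz v x)^*%C * (vert v x)^*%C
      - kk * m.+2%:R * (uc x)^*%C * zc x ^+ 2 * (horiz v x)^*%C ^+ 2).
Proof.
rewrite /dgform; have := Y_conj m x; have := fcoef_conj m x; have := bf_conj x.
move: (fcoef x) (Y x) (horiz v x) (horiz w x) (vert v x) (vert w x) (bf x) (uc x) (zc x).
move=> F y a aw t tw b s z bJ FJ yJ.
rewrite !(conjc_nat, conjc1, conjcK, FJ, yJ, bJ, conjcX, conjcM, conjcB, conjcD).
ring.
Qed.

Lemma del_dgform_bar v x : del v (dgform_bar v) x =
  second_deriv_value kk (zc x) (zc x)^*%C (uc x) (uc x)^*%C (horiz v x) (horiz v x)^*%C
    (vert v x) (vert v x)^*%C (Y x) (fcoef x) (bf x) (b2f x) (v 0 0) (v 0 1).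
Proof.
have hF := has_del_F m v x; have hu := has_del_u v x; have huJ := has_del_uJ v x.
have hz := has_del_z v x; have ha := has_del_horiz v v x; have haJ := has_del_avJ v v x.
have ht := has_del_vert m v v x; have htJ := has_del_thJ v v x.
have hb := has_del_b m v x; have hY := has_del_Y1 m v x.
have h := has_delD (has_delB
  (has_delZ (2 * kk) (has_delM (has_delM (has_delM (has_delM hF hu) ha) htJ) haJ))
  (has_delZ (2 * kk) (has_delM (has_delM (has_delM hY hz) (has_delX 1 haJ)) ha)))
  (has_delM (has_delM hF ht) (has_delB (has_delD
     (has_delM (has_delM (has_delM hb hF) hu) (has_delX 1 htJ))
     (has_delM (has_delM (has_delZ (2 * kk) hz) haJ) htJ))
     (has_delM (has_delM (has_delZ (kk * m.+2%:R) huJ) (has_delX 1 hz)) (has_delX 1 haJ)))).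
have [_ -> _] := h.
rewrite /second_deriv_value (_ : m.+2%:R = kk + 1); last by rewrite -[m.+2]addn1 natrD.
move: (fcoef x) (Y x) (horiz v x) (horiz v x)^*%C (vert v x) (vert v x)^*%C (bf x) (b2f x).
move: (uc x)^*%C (zc x)^*%C (uc x) (zc x) (v 0 0) (v 0 1) => *.
ring.
Qed.

End MetricTensor.

(** * The metric on O(-k) *)

Section ChartChangeDerivative.
Variables (K : numFieldType).
Local Notation V := ('rV[K]_2).

Lemma is_derive_entry (f : V -> V) (x v : V) l : derivable f x v ->
  is_derive x v (fun y => f y 0 l : K) ('D_v f x 0 l).
Proof.
move=> df.
have h : (fun h : K => h^-1 *: (f (h *: v + x) 0 l - f x 0 l)) @ 0^' -->
    'D_v f x 0 l.
  have hc : {for 'D_v f x, continuous (fun M : V => M 0 l)} by exact: coord_continuous.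
  have -> : (fun h : K => h^-1 *: (f (h *: v + x) 0 l - f x 0 l)) =
      (fun h => (h^-1 *: ((f \o shift x) (h *: v) - f x)) 0 l).
    by apply/funext => h; rewrite !mxE.
  exact: (continuous_cvg _ hc df).
split; last exact: cvg_lim h.
by apply/cvg_ex; exists ('D_v f x 0 l).
Qed.

Lemma is_derive_coord (x v : V) l : is_derive x v (fun y => y 0 l : K) (v 0 l).
Proof.
have := @is_derive_entry id x v l (@derivable_id _ _ _ _).
by rewrite derive_id.
Qed.

Definition chart_change_deriv k (x v : V) : V :=
  \row_l (if l == 0 then - v 0 0 / x 0 0 ^+ 2
          else k%:R * x 0 0 ^+ k.-1 * v 0 0 * x 0 1 + x 0 0 ^+ k * v 0 1).

Lemma derive_chart_change k (x v : V) : x 0 0 != 0 ->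
  'D_v (Ominus_chart_change k) x = chart_change_deriv k x v.
Proof.
move=> x0; have df := Ominus_chart_change_differentiable k x0.
have h l := is_derive_entry l (@diff_derivable _ _ _ _ _ v df).
have d0 := is_derive_coord x v 0; have d1 := is_derive_coord x v 1.
apply/rowP => l; rewrite -(@derive_val _ _ _ _ _ _ _ (h l)) [RHS]mxE.
have [->|l0] := eqVneq l 0.
  under eq_fun do rewrite mxE.
  rewrite deriveV//.
  by rewrite (@derive_val _ _ _ _ _ _ _ d0) /GRing.scale/= mulNr mulrC mulNr.
have [_ E] := is_deriveM (is_deriveX k d0) d1.
apply: etrans (etrans _ E) _.
  congr (derive _ x v); apply/funext => y; rewrite mxE (negPf l0).
  by rewrite mulrfctE exprfctE.
by rewrite fctE /GRing.scale/=; ring.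
Qed.

Lemma derive_chart_trans k (i j : 'I_2) (x y v : V) : i != j ->
  Ominus_param k i x = Ominus_param k j y ->
  'D_v (chart_trans (Ominus_param k) i j) x = chart_change_deriv k x v.
Proof.
move=> ij xy; have [x0 _] := (@Ominus_chart_changeP K k _ _ _ _ ij).1 xy.
(* [chart_trans] is given by the explicit formula only where z is nonzero; this set is open, so the
   derivatives agree. *)
rewrite -derive_chart_change//; apply: near_eq_derive.
have : nbhs x [set z : V | z 0 0 != 0].
  by apply: open_nbhs_nbhs; split => //; exact: open_coord_neq0.
apply: filterS => z /= z0; apply: xget_unique.
  by apply/esym/(@Ominus_chart_changeP K k _ _ _ _ ij).
by move=> t /esym /(@Ominus_chart_changeP K k _ _ _ _ ij)[].
Qed.

End ChartChangeDerivative.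

Section OminusMetric.
Variables (R : realType) (m : nat).
Local Notation C := (R[i]).
Local Notation V := ('rV[C]_2).
Local Notation kk := (m.+1%:R : C).
Local Notation Y := (@Y R m).
Local Notation gradn := (@gradn R m).
Local Notation fcoef := (@fcoef R m).
Local Notation vert := (@vert R m).
Local Notation gform := (@gform R m).
Local Notation horiz := (@horiz R).
Local Notation bnorm := (@bnorm R).
Local Notation zc := (@zc R).
Local Notation uc := (@uc R).
Implicit Types (u v w x y : V).

Definition gmx x : 'M[C]_2 := \matrix_(a, b) gform (delta_mx 0 a) (delta_mx 0 b) x.

Lemma horiz_row v x : horiz v x = \sum_a v 0 a * horiz (delta_mx 0 a) x.
Proof.
rewrite !big_ord_recl big_ord0 /horiz !mxE/=.
have -> : lift ord0 ord0 = 1 :> 'I_2 by exact: val_inj.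
rewrite /=; ring.
Qed.

Lemma vert_row v x : vert v x = \sum_a v 0 a * vert (delta_mx 0 a) x.
Proof.
rewrite !big_ord_recl big_ord0 /vert !mxE/=.
have -> : lift ord0 ord0 = 1 :> 'I_2 by exact: val_inj.
rewrite /=; ring.
Qed.

Lemma hform_gmx v w x : hform (gmx x) v w = gform v w x.
Proof.
rewrite /gform horiz_row vert_row (horiz_row w) (vert_row w) /hform.
rewrite !big_ord_recl !big_ord0 !mxE /gform.
set i := lift _ _.
move: (horiz (delta_mx 0 ord0) x) (horiz (delta_mx 0 i) x) => a0 a1.
move: (vert (delta_mx 0 ord0) x) (vert (delta_mx 0 i) x) => t0 t1.
move: (Y x) (fcoef x) => y F.
rewrite !(conjcD, conjcM) conjc0; ring.
Qed.

Lemma smooth_gmx a b : smooth (fun x => gmx x a b).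
Proof.
under eq_fun do rewrite mxE.
have [sG _ _] := @has_del_gform R m (const_mx 0) (delta_mx 0 a) (delta_mx 0 b) (const_mx 0).
exact: sG.
Qed.

Lemma gmx_herm x a b : gmx x b a = (gmx x a b)^*%C.
Proof. by rewrite !mxE gform_conj. Qed.

Lemma gform_parts v x :
  [/\ gform v v x = kk * (1 + Y x) * (horiz v x * (horiz v x)^*%C)
        + fcoef x * (vert v x * (vert v x)^*%C),
    0 <= kk * (1 + Y x) * (horiz v x * (horiz v x)^*%C) &
    0 <= fcoef x * (vert v x * (vert v x)^*%C)].
Proof.
split; first by rewrite /gform !mulrA.
  rewrite mulr_ge0 ?mulcJ_ge0//; apply: mulr_ge0 => //.
  by apply: ltW; exact: Y1_gt0.
rewrite mulr_ge0 ?mulcJ_ge0//; apply: ltW; exact: fcoef_gt0.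
Qed.

Lemma gform_ge0 v x : 0 <= gform v v x.
Proof. by have [-> h1 h2] := gform_parts v x; rewrite addr_ge0. Qed.

Lemma gmx_pos x v : v != 0 -> 0 < hform (gmx x) v v.
Proof.
move=> v0; rewrite hform_gmx lt_neqAle gform_ge0 andbT eq_sym.
apply: contra_neq v0 => /eqP; have [-> h1 h2] := gform_parts v x.
rewrite paddr_eq0// => /andP[e1 e2].
have t0 : vert v x = 0.
  by move: e2; rewrite mulf_eq0 (negPf (fcoef_neq0 m x))/= mulf_eq0 conjc_eq0 orbb => /eqP.
have a0 : horiz v x = 0.
  move: e1; rewrite mulf_eq0 mulf_eq0 pnatr_eq0 (negPf (Y1_neq0 m x))/=.
  by rewrite mulf_eq0 conjc_eq0 orbb => /eqP.
have v00 : v 0 0 = 0.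
  by apply: (mulIf (invr_neq0 (bnorm_neq0 x))); rewrite mul0r.
apply/rowP => -[[|[|//]] h]; rewrite mxE.
  by rewrite -[RHS]v00; congr (v _ _); exact: val_inj.
move: t0; rewrite /vert v00 mulr0 mul0r addr0 => <-; congr (v _ _); exact: val_inj.
Qed.

(** [rho] is intrinsic: it is the squared norm of the fibre element for the metric on O(-k) induced
    from C^2. In coordinates, |z^k u|^2 (1 + 1/|z|^2)^k = |u|^2 (|z|^2 + 1)^k. *)
Lemma rho_change x : zc x != 0 -> rho m (Ominus_chart_change m.+1 x) = rho m x.
Proof.
move=> z0; have zJ0 : (zc x)^*%C != 0 by rewrite conjc_eq0.
rewrite /rho /bnorm /uc /zc !mxE/= conjc_inv conjcM conjcX -/(zc x) -/(uc x).
have -> : 1 + (zc x)^-1 / (zc x)^*%C = (1 + zc x * (zc x)^*%C) / (zc x * (zc x)^*%C).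
  by field; rewrite z0 zJ0.
rewrite expr_div_n exprMn; field.
by rewrite !expf_neq0.
Qed.

(** Y is invariant, [horiz] is multiplied by the unit number -zbar / z, [vert] by z^k and [fcoef] by
    |z|^(-2k); the factors cancel in both terms. *)
Lemma gform_change v w x : zc x != 0 ->
  gform v w x = gform (chart_change_deriv m.+1 x v) (chart_change_deriv m.+1 x w)
    (Ominus_chart_change m.+1 x).
Proof.
move=> z0; have zJ0 : (zc x)^*%C != 0 by rewrite conjc_eq0.
have YE : Y (Ominus_chart_change m.+1 x) = Y x by rewrite /Y /Yr rho_change.
have fE : bnorm (Ominus_chart_change m.+1 x) = bnorm x / (zc x * (zc x)^*%C).
  by rewrite /bnorm /zc !mxE/= -/(zc x) conjc_inv; field; rewrite z0 zJ0.
have FE : fcoef (Ominus_chart_change m.+1 x) = fcoef x / (zc x * (zc x)^*%C) ^+ m.+1.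
  by rewrite /fcoef /gradn YE fE expr_div_n mulrAC.
have aE u : horiz (chart_change_deriv m.+1 x u) (Ominus_chart_change m.+1 x) =
    - (zc x)^*%C / zc x * horiz u x.
  by rewrite /horiz fE mxE/= -/(zc x); field; rewrite bnorm_neq0 z0 zJ0.
have tE u : vert (chart_change_deriv m.+1 x u) (Ominus_chart_change m.+1 x) =
    zc x ^+ m.+1 * vert u x.
  rewrite /vert fE /uc /zc !mxE/= -/(zc x) -/(uc x) conjc_inv.
  have fE' : zc x * (zc x)^*%C = bnorm x - 1 by rewrite /bnorm; ring.
  have f0 := bnorm_neq0 x.
  rewrite exprS; set X := _ ^+ m; set d := kk.
  transitivity (zc x * X * u 0 1 + d * X * u 0 0 * uc x * ((bnorm x - 1) / bnorm x)).
    field; by rewrite ?z0 ?zJ0 ?f0.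
  by rewrite -fE'; field.
rewrite /gform YE FE !aE !tE.
have := vert_conj m w x.
move: (horiz v x) (horiz w x) (vert v x) (vert w x) (Y x) (fcoef x) => a b t s y F _.
rewrite !(conjcM, conjcX, conjcN, conjc_inv, conjcK) exprMn; field.
by rewrite z0 zJ0 !expf_neq0.
Qed.

End OminusMetric.

(** * Kahler condition, sectional curvature and rank *)

Section OminusGeometry.
Variables (R : realType) (m : nat).
Local Notation C := (R[i]).
Local Notation V := ('rV[C]_2).
Local Notation kk := (m.+1%:R : C).
Local Notation Y := (@Y R m).
Local Notation gradn := (@gradn R m).
Local Notation fcoef := (@fcoef R m).
Local Notation vert := (@vert R m).
Local Notation gform := (@gform R m).
Local Notation dgform := (@dgform R m).
Local Notation bf := (@bf R m).
Local Notation horiz := (@horiz R).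
Local Notation bnorm := (@bnorm R).
Local Notation zc := (@zc R).
Local Notation uc := (@uc R).
Local Notation gmx := (@gmx R m).
Local Notation M := (Ominus R[i] m.+1).
Implicit Types (u v w x y : V).

Lemma gmx_trans (i j : chart M) x y : param M i x = param M j y -> forall v w,
  hform (gmx x) v w = hform (gmx y) ('D_v (chart_trans (param M) i j) x)
                                  ('D_w (chart_trans (param M) i j) x).
Proof.
move=> xy v w; have [ij|ij] := eqVneq i j.
  move: xy; rewrite -ij => /param_inj <-.
  have -> : chart_trans (param M) i i = id.
    by apply/funext => z; apply: xget_unique => // t; exact: param_inj.
  by rewrite !derive_id.
have [x0 yE] := (@Ominus_chart_changeP R[i] m.+1 _ _ _ _ ij).1 xy.
by rewrite !(derive_chart_trans _ ij xy) yE !hform_gmx -gform_change.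
Qed.

Definition ominus_metric : hermitian_metric M :=
  @HermitianMetric R 2 M (fun=> gmx) (fun _ a b => smooth_csmooth (@smooth_gmx R m a b))
    (fun _ => @gmx_herm R m) (fun _ => @gmx_pos R m) gmx_trans.

Lemma rderive_fundamental_form (i : chart M) u v w x :
  rderive u (fundamental_form ominus_metric i v w) x =
  - Im (dgform u v w x) + Im (dgform u w v x).
Proof.
have -> : fundamental_form ominus_metric i v w = fun y => Im (- gform v w y).
  by apply/funext => y; rewrite /fundamental_form /= hform_gmx; case: (gform v w y).
have [sG h1 h2] := has_delN (has_del_gform m u v w x).
rewrite rderive_Im// h1 h2.
by case: (dgform u v w x) (dgform u w v x) => [a b] [c d] /=; rewrite opprK.
Qed.

(** Each term contributes the imaginary parts of two values of [dgform]; by [TfC] the six values of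
    the cyclic sum cancel in pairs. *)
Lemma ominus_kahler : kahler ominus_metric.
Proof.
move=> i u v w x; rewrite /d_fundamental_form !rderive_fundamental_form.
rewrite (TfC m v u w) (TfC m w u v) (TfC m w v u); ring.
Qed.

Lemma gmx_unit x : gmx x \in unitmx.
Proof.
rewrite -row_free_unit; apply: inj_row_free => v vG; apply/eqP/negPn/negP => v0.
have := gmx_pos m x v0.
have -> : hform (gmx x) v v = \sum_b (v *m gmx x) 0 b * (v 0 b)^*%C.
  rewrite /hform exchange_big; apply: eq_bigr => b _ /=.
  by rewrite mxE mulr_suml; apply: eq_bigr => a _; rewrite [v 0 a * _]mulrC.
by rewrite vG big1 ?ltxx// => b _; rewrite mxE mul0r.
Qed.

(** Once the first derivative of the metric is represented as pairing with a vector X, this turns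
    the quadratic term of the curvature into the squared length of X, without inverting the
    matrix. *)
Lemma sum_invmx_gmx x (X : V) :
  \sum_p \sum_q invmx (gmx x) p q * gform X (delta_mx 0 p) x *
    gform (delta_mx 0 q) X x = gform X X x.
Proof.
rewrite exchange_big -[RHS]hform_gmx.
transitivity (\sum_q X 0 q * gform (delta_mx 0 q) X x); last first.
  rewrite /hform; apply: eq_bigr => q _; rewrite -hform_gmx hform_deltal mulr_sumr.
  by apply: eq_bigr => b _; rewrite mulrCA mulrA.
apply: eq_bigr => q _; rewrite -mulr_suml; congr (_ * _).
rewrite -[in RHS](mulmxK (gmx_unit x) X) mxE; apply: eq_bigr => p _.
rewrite mulrC; congr (_ * _).
by rewrite -hform_gmx hform_deltar mxE; apply: eq_bigr => b _; rewrite mulrC.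
Qed.

(* Up to a scalar, the Hessian |a|^2 + |b|^2 - k |w|^2 of the moment map on the
   horizontal lift of [v]: it has signature (1, 1) everywhere. *)
Definition null_form v x := (1 + Y x) * (horiz v x * (horiz v x)^*%C)
  - fcoef x * (vert v x * (vert v x)^*%C) / gradn x.

Lemma hsc_numerator (i : chart M) v x :
  \sum_a \sum_b \sum_c \sum_d curvature ominus_metric i x a b c d *
     v 0 a * (v 0 b)^*%C * v 0 c * (v 0 d)^*%C =
  2 * kk / gradn x * null_form v x ^+ 2.
Proof.
rewrite curvature_sum => [|a b]; last exact: smooth_gmx.
have GE u w : (fun y => hform (ominus_metric i y) u w) = gform u w.
  by apply/funext => y; rewrite /= hform_gmx.
have -> : delbar v (fun y => hform (ominus_metric i y) v v) = dgform_bar m v.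
  rewrite GE; apply/funext => y; have [_ _ ->] := has_del_gform m v v v y.
  by rewrite dgform_conj.
pose c1 := 2 * kk * horiz v x *
  (fcoef x * (uc x)^*%C * vert v x - (1 + Y x) * (zc x)^*%C * horiz v x).
pose c2 := fcoef x * (bf x * fcoef x * (uc x)^*%C * vert v x ^+ 2
    + 2 * kk * (zc x)^*%C * horiz v x * vert v x
    - kk * m.+2%:R * uc x * (zc x)^*%C ^+ 2 * horiz v x ^+ 2).
have f0 := bnorm_neq0 x; have F0 := fcoef_neq0 m x; have Y0 := Y1_neq0 m x.
have k0 : kk != 0 by rewrite pnatr_eq0.
(* X represents [dgform v v] with respect to the metric. In the diagonalizing coframe its components
   are [c1] and [c2] divided by the diagonal coefficients; the entries below undo [horiz] and
   [vert]. *)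
pose X : V := \row_l (if l == 0 then bnorm x * c1 / (kk * (1 + Y x))
   else c2 / fcoef x - kk * uc x * (zc x)^*%C * (c1 / (kk * (1 + Y x)))).
have aX : horiz X x = c1 / (kk * (1 + Y x)).
  by rewrite /horiz /X mxE/=; move: (kk) k0 => d d0; field; rewrite f0 Y0 d0.
have tX : vert X x = c2 / fcoef x.
  by rewrite /vert /X !mxE/=; move: (kk) k0 => d d0; field; rewrite f0 Y0 F0 d0.
have TG w : dgform v v w x = gform X w x.
  rewrite /gform aX tX /dgform /c1 /c2.
  move: (fcoef x) (Y x) (horiz v x) (vert v x) (horiz w x)^*%C (vert w x)^*%C (bf x) F0 Y0.
  move: (kk) (m.+2%:R : C) k0 => *.
  by field; do ?[apply/andP; split].
have -> : \sum_p \sum_q invmx (ominus_metric i x) p q *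
    del v (fun y => hform (ominus_metric i y) v (delta_mx 0 p)) x *
    delbar v (fun y => hform (ominus_metric i y) (delta_mx 0 q) v) x = gform X X x.
  rewrite -sum_invmx_gmx; apply: eq_bigr => p _; apply: eq_bigr => q _.
  rewrite !GE; have [_ -> _] := has_del_gform m v v (delta_mx 0 p) x.
  have [_ _ ->] := has_del_gform m v (delta_mx 0 q) v x.
  by rewrite !TG gform_conj.
have GX : gform X X x = c1 * c1^*%C / (kk * (1 + Y x)) + c2 * c2^*%C / fcoef x.
  rewrite /gform aX tX; have := Y_conj m x; have := fcoef_conj m x.
  move: (fcoef x) (Y x) c1 c2 F0 Y0 {aX tX X TG} => F y c1 c2 F0 Y0 FJ yJ.
  rewrite !(conjc_nat, conjc1, FJ, yJ, conjc_inv, conjcM, conjcD).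
  by move: (kk) k0 => d d0; field; rewrite F0 Y0 d0.
have c1J : c1^*%C = 2 * kk * (horiz v x)^*%C *
    (fcoef x * uc x * (vert v x)^*%C - (1 + Y x) * zc x * (horiz v x)^*%C).
  rewrite /c1; have := Y_conj m x; have := fcoef_conj m x.
  move: (fcoef x) (Y x) (horiz v x) (vert v x) (uc x) (zc x) => F y a t s z FJ yJ.
  by rewrite !(conjc_nat, conjc1, conjcK, FJ, yJ, conjcX, conjcM, conjcB, conjcD).
have c2J : c2^*%C = fcoef x * (bf x * fcoef x * uc x * (vert v x)^*%C ^+ 2
    + 2 * kk * zc x * (horiz v x)^*%C * (vert v x)^*%C
    - kk * m.+2%:R * (uc x)^*%C * zc x ^+ 2 * (horiz v x)^*%C ^+ 2).
  rewrite /c2; have := bf_conj m x; have := fcoef_conj m x.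
  move: (fcoef x) (bf x) (horiz v x) (vert v x) (uc x) (zc x) => F y a t s z FJ yJ.
  by rewrite !(conjc_nat, conjc1, conjcK, FJ, yJ, conjcX, conjcM, conjcB, conjcD).
rewrite GX del_dgform_bar c1J c2J /c1 /c2 /null_form.
have NE : gradn x = 1 + (kk + 1) * Y x by rewrite /gradn -[m.+2]addn1 natrD.
have N0 := gradn_neq0 m x.
have h := @curvature_square C kk (zc x) (zc x)^*%C (uc x) (uc x)^*%C
  (horiz v x) (horiz v x)^*%C
  (vert v x) (vert v x)^*%C (Y x) (fcoef x) (v 0 0) (v 0 1).
have kE : m%:R = kk - 1 by rewrite -[m.+1]addn1 natrD addrK.
have k2E : m.+2%:R = kk + 1 :> C by rewrite -[m.+2]addn1 natrD.
rewrite NE in N0 *; rewrite /bf /b2f NE kE k2E; apply: h => //.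
- by rewrite /horiz -/(bnorm x) divfK.
- by rewrite /vert /horiz; field.
- rewrite -NE /fcoef; have := Y_rho m x; rewrite /rho => h.
  have A0 : (1 + Y x) ^+ m != 0 by rewrite expf_neq0.
  transitivity (uc x * (uc x)^*%C * bnorm x ^+ m.+1 / (1 + Y x) ^+ m).
    rewrite -NE in N0; by field; rewrite A0 N0.
  by rewrite -h exprS; field.
- by rewrite conjc_eq0.
Qed.

Lemma hsc_denominator (i : chart M) v x :
  \sum_a \sum_b \sum_c \sum_d ominus_metric i x a b * ominus_metric i x c d *
     v 0 a * (v 0 b)^*%C * v 0 c * (v 0 d)^*%C = gform v v x ^+ 2.
Proof.
rewrite -hform_gmx expr2 {1}/hform mulr_suml; apply: eq_bigr => a _.
rewrite mulr_suml; apply: eq_bigr => b _.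
rewrite /hform mulr_sumr; apply: eq_bigr => c _.
by rewrite mulr_sumr; apply: eq_bigr => d _ /=; ring.
Qed.

Lemma hscE (i : chart M) v x : hol_sect_curv ominus_metric i x v =
  2 * kk / gradn x * null_form v x ^+ 2 / gform v v x ^+ 2.
Proof. by rewrite /hol_sect_curv hsc_numerator hsc_denominator. Qed.

Lemma null_form_conj v x : (null_form v x)^*%C = null_form v x.
Proof.
rewrite /null_form; have := Y_conj m x; have := fcoef_conj m x; have := gradn_conj m x.
move: (fcoef x) (Y x) (gradn x) (horiz v x) (vert v x) => F y N a t NJ FJ yJ.
rewrite !(conjc1, conjcK, FJ, yJ, NJ, conjc_inv, conjcM, conjcB, conjcD); ring.
Qed.

Lemma ominus_semipositive : semipositive_hsc ominus_metric.
Proof.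
move=> i x v v0; rewrite hscE.
have Q0 : 0 <= null_form v x ^+ 2 by rewrite expr2 -{2}null_form_conj mulcJ_ge0.
rewrite divr_ge0 ?exprn_ge0 ?gform_ge0// mulr_ge0// divr_ge0 ?mulr_ge0//.
by apply: ltW; exact: gradn_gt0.
Qed.

(** A plane is the whole tangent space and contains the fibre direction, where [horiz] vanishes and
    [null_form] equals - [fcoef] / [gradn]. *)
Lemma no_flat_plane p : ~ has_flat_subspace ominus_metric p 2.
Proof.
move=> [i [x [L [_ dL h]]]].
have Lf : L = fullv by apply/eqP; rewrite eqEdim subvf/= dimvf dL.
pose v : V := delta_mx 0 1.
have v0 : v != 0.
  by apply/eqP => /rowP/(_ 1); rewrite !mxE eqxx => /eqP; rewrite oner_eq0.
have /(_ v) := h; rewrite Lf memvf => /(_ isT v0); rewrite hscE.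
have N0 := gradn_neq0 m x; have F0 := fcoef_neq0 m x.
have G0 : gform v v x != 0 by have := gmx_pos m x v0; rewrite hform_gmx => /gt_eqF ->.
have QE : null_form v x = - (fcoef x / gradn x).
  by rewrite /null_form /horiz /vert !mxE/= mulr0 !mul0r addr0 conjc1 !mulr1 mulr0 sub0r.
move/eqP; rewrite QE sqrrN; apply/negP.
have FN0 : fcoef x / gradn x != 0 by apply: mulf_neq0 => //; rewrite invr_eq0.
apply: mulf_neq0; last by rewrite invr_eq0 expf_neq0.
apply: mulf_neq0; last by rewrite expf_neq0.
by rewrite !mulf_neq0 ?invr_eq0 ?pnatr_eq0.
Qed.

Lemma flat_line p : has_flat_subspace ominus_metric p 1.
Proof.
have [i [x xp]] := param_cover p.
have N0 := gradn_gt0 m x; have F0 := fcoef_gt0 m x; have Y0 := Y1_gt0 m x.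
(* With [horiz] = s and [vert] = t the two terms of [null_form] cancel; v is then found by inverting
   the coframe. *)
pose s := sqrtC (fcoef x / gradn x); pose t := sqrtC (1 + Y x).
have sE : s * s^*%C = fcoef x / gradn x.
  have s0 : 0 <= s by rewrite sqrtC_ge0 divr_ge0 ?ltW.
  have -> : s^*%C = s by rewrite -(RRe_real (ger0_real s0)) conjc_real.
  by rewrite -expr2 sqrtCK.
have tE : t * t^*%C = 1 + Y x.
  have s0 : 0 <= t by rewrite sqrtC_ge0 ltW.
  have -> : t^*%C = t by rewrite -(RRe_real (ger0_real s0)) conjc_real.
  by rewrite -expr2 sqrtCK.
have f0 := bnorm_neq0 x.
pose v : V := \row_l (if l == 0 then bnorm x * s else t - kk * uc x * (zc x)^*%C * s).
have horiz_v : horiz v x = s by rewrite /horiz mxE/= mulrC mulKf.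
have vert_v : vert v x = t by rewrite /vert !mxE/=; field.
have v0 : v != 0.
  apply: contraTneq Y0 => v0.
  have t0 : t = 0 by rewrite -vert_v /vert v0 !mxE mulr0 mul0r addr0.
  by rewrite -tE t0 mul0r ltxx.
exists i, x, <[v]>%VS; split => //; first by rewrite dim_vline v0.
move=> _ /vlineP[l ->] lv0; rewrite hscE.
have -> : null_form (l *: v) x = 0.
  have -> : null_form (l *: v) x = l * l^*%C * null_form v x.
    rewrite /null_form.
    have -> : horiz (l *: v) x = l * horiz v x by rewrite /horiz mxE mulrA.
    have -> : vert (l *: v) x = l * vert v x by rewrite /vert !mxE; field.
    by move: (horiz v x) (vert v x) => a b; rewrite !conjcM; ring.
  by rewrite /null_form horiz_v vert_v sE tE mulrA [_ * (1 + Y x)]mulrC subrr mulr0.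
by rewrite expr0n mulr0 mul0r.
Qed.

Lemma eta_ominus p : eta ominus_metric p = 1%N.
Proof.
rewrite /eta !big_mkcond !big_ord_recl big_ord0/=.
by do ?[case: asboolP => //] => ? ? ?; have := flat_line p; have := @no_flat_plane p.
Qed.

Lemma ominus_rank : rank_plus ominus_metric = 1%N.
Proof.
have p0 : M := Ominus_param m.+1 0 (const_mx 0).
have E k : `[< exists p, eta ominus_metric p = k >] = (k == 1%N).
  apply/asboolP/eqP => [[p]|->]; first by rewrite eta_ominus.
  by exists p0; rewrite eta_ominus.
(* Only k = 1 survives in the minimum, and it lies below the default value 2. *)
rewrite /rank_plus /eta_min; under eq_bigl do rewrite E.
have -> : index_enum 'I_3 = enum 'I_3 by rewrite enumT.
by rewrite !enum_ordSl enum_ord0 /= !big_cons big_nil.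
Qed.

End OminusGeometry.

(** * Completeness *)

Section Lengths.
Variable R : realType.

Lemma is_derive_continuous (f : R -> R) (t d : R) :
  is_derive t 1 f d -> {for t, continuous f}.
Proof. by move=> [h _]; exact/differentiable_continuous/derivable1_diffP. Qed.

Lemma continuous_EFin_measurable (f : R -> R) (D : set R) :
  continuous f -> measurable_fun D (EFin \o f).
Proof.
move=> cf; apply/measurable_EFinP; apply: measurable_funS (measurableT) _ _ => //.
exact: continuous_measurable_fun.
Qed.

Lemma increment_le_integral (phi dphi speed : R -> R) :
  (forall t : R, is_derive t 1 phi (dphi t)) -> continuous dphi ->
  continuous speed -> (forall t, `|dphi t| <= speed t) ->
  (`|phi 1 - phi 0|%:E <=
   \int[lebesgue_measure]_(t in `[0%R, 1%R]) (speed t)%:E)%E.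
Proof.
move=> hphi cdphi cspeed hle.
have phic : continuous phi by move=> t; exact: is_derive_continuous (hphi t).
have E : (\int[lebesgue_measure]_(x in `[0%R, 1%R]) (dphi x)%:E =
    (phi 1)%:E - (phi 0)%:E)%E.
  apply: continuous_FTC2 => //.
  - exact: continuous_subspaceT.
  - split => [t _||]; first by have [] := hphi t.
      by apply: cvg_at_right_filter; exact: phic.
    by apply: cvg_at_left_filter; exact: phic.
  - by move=> t _; rewrite derive1E; have [_ ->] := hphi t.
have -> : (`|phi 1 - phi 0|%:E =
    `|\int[lebesgue_measure]_(x in `[0%R, 1%R]) (dphi x)%:E|)%E.
  by rewrite E -EFinB.
apply: le_trans (le_abse_integral _ _ _) _ => //; first exact: continuous_EFin_measurable.
apply: ge0_le_integral => //.
- by apply: measurableT_comp => //; exact: continuous_EFin_measurable.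
- exact: continuous_EFin_measurable.
- by move=> t _; rewrite /= lee_fin.
Qed.

Lemma integral_unit_le (speed : R -> R) (e : R) : continuous speed ->
  (forall t, 0 <= speed t) -> (forall t, 0 <= t <= 1 -> speed t <= e) ->
  (\int[lebesgue_measure]_(t in `[0%R, 1%R]) (speed t)%:E <= e%:E)%E.
Proof.
move=> cspeed s0 hle.
have -> : e%:E = (\int[lebesgue_measure]_(t in `[0%R, 1%R]) (cst e%:E t))%E :> \bar R.
  rewrite integral_cst//= lebesgue_measure_itv/= lte_fin ltr01.
  by rewrite -EFinB subr0 mule1.
apply: ge0_le_integral => //.
- by move=> t _; rewrite lee_fin.
- exact: continuous_EFin_measurable.
Qed.

Definition ccontinuous (f : R -> R[i]) :=
  continuous (fun t => Re (f t)) /\ continuous (fun t => Im (f t)).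

Lemma cder_ccontinuous f : (forall t, exists d, cder f t d) -> ccontinuous f.
Proof.
move=> h; split=> t; have [d [h1 h2]] := h t; first exact: is_derive_continuous h1.
exact: is_derive_continuous h2.
Qed.

Lemma ccontinuous_cst c : ccontinuous (fun=> c).
Proof. by apply: cder_ccontinuous => t; exists 0; exact: cder_cst. Qed.

Lemma ccontinuousD f g : ccontinuous f -> ccontinuous g ->
  ccontinuous (fun t => f t + g t).
Proof.
move=> [f1 f2] [g1 g2]; split => t.
  by under eq_fun do rewrite Re_add; apply: cvgD; [exact: f1|exact: g1].
by under eq_fun do rewrite Im_add; apply: cvgD; [exact: f2|exact: g2].
Qed.

Lemma ccontinuousM f g : ccontinuous f -> ccontinuous g ->
  ccontinuous (fun t => f t * g t).
Proof.
move=> [f1 f2] [g1 g2]; split => t.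
  under eq_fun do rewrite Re_mul.
  by apply: cvgB; apply: cvgM; [exact: f1|exact: g1|exact: f2|exact: g2].
under eq_fun do rewrite Im_mul.
by apply: cvgD; apply: cvgM; [exact: f1|exact: g2|exact: f2|exact: g1].
Qed.

Lemma ccontinuousJ f : ccontinuous f -> ccontinuous (fun t => (f t)^*%C).
Proof.
move=> [f1 f2]; split => t.
  by under eq_fun do rewrite Re_conjc; exact: f1.
by under eq_fun do rewrite Im_conjc; apply: cvgN; exact: f2.
Qed.

Lemma ccontinuous_sum (I : Type) (r : seq I) (f : I -> R -> R[i]) :
  (forall i, ccontinuous (f i)) -> ccontinuous (fun t => \sum_(i <- r) f i t).
Proof.
move=> h; elim: r => [|i r IHr].
  by under eq_fun do rewrite big_nil; exact: ccontinuous_cst.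
by under eq_fun do rewrite big_cons; exact: ccontinuousD.
Qed.

Lemma smooth_ccontinuous n (F : 'rV[R[i]]_n -> R[i]) (c : R -> 'rV[R[i]]_n)
    (w : R -> 'rV[R[i]]_n) : smooth F -> (forall t, ccurve c t (w t)) ->
  ccontinuous (fun t => F (c t)).
Proof.
move=> sF h; apply: cder_ccontinuous => t.
by eexists; exact: cder_comp sF (h t).
Qed.

Lemma C1_ccurve n (c : R -> 'rV[R[i]]_n) t : C1_curve c -> ccurve c t (velocity c t).
Proof.
move=> h j; have [h1 h2 _ _] := h j; rewrite /velocity mxE; split => /=.
  by rewrite derive1E; apply: derivableP.
by rewrite derive1E; apply: derivableP.
Qed.

Lemma C1_velocity n (c : R -> 'rV[R[i]]_n) j : C1_curve c ->
  ccontinuous (fun t => velocity c t 0 j).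
Proof.
move=> /(_ j)[_ _ h1 h2]; rewrite /velocity; split.
  by under eq_fun do rewrite mxE/=.
by under eq_fun do rewrite mxE/=.
Qed.

Lemma speed_continuous n (g : 'rV[R[i]]_n -> 'M[R[i]]_n) (c : R -> 'rV[R[i]]_n) :
  (forall a b, smooth (fun x => g x a b)) -> C1_curve c ->
  continuous (fun t => Num.sqrt (Re (hform (g (c t)) (velocity c t) (velocity c t)))).
Proof.
move=> sg hc.
have h : ccontinuous (fun t => hform (g (c t)) (velocity c t) (velocity c t)).
  apply: ccontinuous_sum => a; apply: ccontinuous_sum => b.
  apply: ccontinuousM; last by apply: ccontinuousJ; exact: C1_velocity.
  apply: ccontinuousM; last exact: C1_velocity.
  apply: (smooth_ccontinuous (w := velocity c) (sg a b)) => t; exact: C1_ccurve.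
move=> t; have [h1 _] := h.
exact: (continuous_comp (h1 t) (@sqrt_continuous _ _)).
Qed.

End Lengths.

(** * A chart-independent function with increments bounded by length *)

Section OminusLengths.
Variables (R : realType) (m : nat).
Local Notation C := (R[i]).
Local Notation V := ('rV[C]_2).
Local Notation Y := (@Y R m).
Local Notation Yr := (@Yr R m).
Local Notation gradn := (@gradn R m).
Local Notation fcoef := (@fcoef R m).
Local Notation vert := (@vert R m).
Local Notation gform := (@gform R m).
Local Notation uc := (@uc R).
Local Notation rho := (@rho R m).
Local Notation M := (Ominus R[i] m.+1).
Local Notation g := (@ominus_metric R m).
Implicit Types (u v w x y : V).

(** The logarithm of sqrt (|a|^2 + |b|^2), as |a|^2 + |b|^2 = 1 + Y on the level set. Its Lipschitz
    constant is 1 for [gform], and its sublevel sets are those of Y. *)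
Definition log_rad x : R := 2^-1 * ln (1 + Yr x).

(** The left-hand side is half the derivative of Y along [v], in absolute value. By the moment
    relation the modulus squared is (Y / [gradn]) (1 + Y) [fcoef] |[vert]|^2, and Y <= [gradn]. *)
Lemma dY_bound v x : `|Re (fcoef x * (uc x)^*%C * vert v x)| <=
  (1 + Yr x) * Num.sqrt (Re (gform v v x)).
Proof.
set A := _ * vert v x; have Y0 := Yr_ge0 m x.
have N0 := gradn_gt0 m x; have F0 := fcoef_gt0 m x; have Y1 := Y1_gt0 m x.
have UF : uc x * (uc x)^*%C * fcoef x = Y x * (1 + Y x) / gradn x.
  rewrite /fcoef; have := Y_rho m x; rewrite /rho => h.
  have A0 : (1 + Y x) ^+ m != 0 by rewrite expf_neq0 ?Y1_neq0.
  rewrite mulrA -h exprS; have Nx := gradn_neq0 m x; field; by rewrite A0 Nx.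
have h1 : A * A^*%C <= (1 + Y x) ^+ 2 * gform v v x.
  have -> : A * A^*%C = Y x / gradn x * (1 + Y x) * (fcoef x * (vert v x * (vert v x)^*%C)).
    transitivity ((uc x * (uc x)^*%C * fcoef x) * (fcoef x * (vert v x * (vert v x)^*%C))).
      rewrite /A; have := fcoef_conj m x; move: (fcoef x) (vert v x) => F t FJ.
      by rewrite !conjcM conjcK FJ; ring.
    by rewrite UF; ring.
  have [-> G1 G2] := gform_parts m v x.
  apply: (@le_trans _ _ ((1 + Y x) ^+ 2 * (fcoef x * (vert v x * (vert v x)^*%C)))).
    apply: ler_wpM2r => //; rewrite expr2; apply: ler_wpM2r; first exact: ltW.
    rewrite ler_pdivrMr// /gradn; have Y0' := Y_ge0 m x.
    apply: (@le_trans _ _ (1 * (1 + m.+2%:R * Y x))).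
      by rewrite mul1r -[leLHS]add0r lerD// ler_peMl// ler1n.
    by rewrite ler_wpM2r ?lerDl// addr_ge0// mulr_ge0.
  by rewrite ler_wpM2l ?lerDr// exprn_ge0// ltW.
have h2 : Re A ^+ 2 <= (1 + Yr x) ^+ 2 * Re (gform v v x).
  have E : (1 + Y x) ^+ 2 * gform v v x = ((1 + Yr x) ^+ 2)%:C%C * gform v v x.
    by rewrite rmorphXn rmorphD rmorph1.
  move: h1; rewrite E lecE => /andP[_].
  rewrite [X in _ <= X]Re_mul/= mul0r subr0; apply: le_trans.
  rewrite [leRHS]Re_mul Re_conjc Im_conjc mulrN opprK -!expr2 lerDl; exact: sqr_ge0.
rewrite -sqrtr_sqr -[X in X * _]ger0_norm ?addr_ge0// -sqrtr_sqr -sqrtrM ?sqr_ge0//.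
by apply: ler_wsqrtr.
Qed.

Lemma curve_length_ge (i : chart M) (c : R -> V) : C1_curve c ->
  (`|log_rad (c 1%R) - log_rad (c 0%R)|%:E <= curve_length g i c)%E.
Proof.
move=> hc; pose w := velocity c.
have cw t : ccurve c t (w t) by exact: C1_ccurve.
pose B t := Re (fcoef (c t) * (uc (c t))^*%C * vert (w t) (c t)).
have dYr (t : R) : is_derive t 1 (fun s => Yr (c s)) (2 * B t).
  have [h1 _] := cder_comp (@smooth_Y R m) (cw t).
  have [_ E1 E2] := has_del_Y m (w t) (c t).
  move: h1; rewrite E1 E2 /B.
  have -> : fcoef (c t) * uc (c t) * (vert (w t) (c t))^*%C =
      (fcoef (c t) * (uc (c t))^*%C * vert (w t) (c t))^*%C.
    have := fcoef_conj m (c t); move: (fcoef (c t)) (vert (w t) (c t)) => F s FJ.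
    by rewrite !conjcM conjcK FJ.
  by rewrite Re_add Re_conjc -mulr2n mulr_natl; exact: id.
have Y1 t : 0 < 1 + Yr (c t) by rewrite ltr_wpDr// Yr_ge0.
have dphi (t : R) : is_derive t 1 (fun s => log_rad (c s)) (B t / (1 + Yr (c t))).
  have d1 : is_derive t 1 (fun s => 1 + Yr (c s)) (2 * B t).
    by have := is_deriveD (is_derive_cst (1 : R) t 1) (dYr t); rewrite add0r.
  have d2 := @is_derive1_comp R (@ln R) (fun s => 1 + Yr (c s)) t _ _
    (is_derive1_ln (Y1 t)) d1.
  have := is_deriveZ 2^-1 d2; move/is_derive_eq; apply.
  by rewrite /GRing.scale/=; field; rewrite gt_eqF.
apply: (@increment_le_integral R (fun t => log_rad (c t)) _ _ dphi).
- have cB : continuous B.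
    have cth : ccontinuous (fun t => vert (w t) (c t)).
      apply: ccontinuousD; first exact: C1_velocity.
      have -> : (fun t => m.+1%:R * uc (c t) * (zc (c t))^*%C * w t 0 0 / bnorm (c t)) =
          fun t => (m.+1%:R * uc (c t) * (zc (c t))^*%C / bnorm (c t)) * w t 0 0.
        by apply/funext => t; rewrite mulrAC.
      apply: ccontinuousM; last exact: C1_velocity.
      apply: (@smooth_ccontinuous _ _
        (fun x => m.+1%:R * uc x * (zc x)^*%C / bnorm x) c w) => //.
      apply: smoothM; last by apply: smoothV; [exact: bnorm_neq0|exact: smooth_bnorm].
      apply: smoothM; last by apply: smoothJ; exact: smooth_coord.
      by apply: smoothM; [exact: smooth_cst|exact: smooth_coord].
    have cFu : ccontinuous (fun t => fcoef (c t) * (uc (c t))^*%C).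
      apply: (@smooth_ccontinuous _ _ (fun x => fcoef x * (uc x)^*%C) c w) => //.
      apply: smoothM; last by apply: smoothJ; exact: smooth_coord.
      by have [] := has_del_F m 0 (0 : V).
    by have [] := ccontinuousM cFu cth.
  move=> t; apply: cvgM; first exact: cB.
  apply: cvgV; first by rewrite gt_eqF.
  by apply: cvgD; [exact: cvg_cst|exact: is_derive_continuous (dYr t)].
- by apply: speed_continuous => // a b; exact: smooth_gmx.
- move=> t; rewrite normrM normfV (ger0_norm (ltW (Y1 t))) ler_pdivrMr//.
  by rewrite /= hform_gmx mulrC; exact: dY_bound.
Qed.

Lemma param_rho (i j : chart M) x y : param M i x = param M j y -> rho x = rho y.
Proof.
have [->|ij] := eqVneq i j; first by move=> /param_inj ->.
move=> /(@Ominus_chart_changeP R[i] m.+1 _ _ _ _ ij)[x0 ->].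
by rewrite rho_change.
Qed.

Lemma param_log_rad (i j : chart M) x y :
  param M i x = param M j y -> log_rad x = log_rad y.
Proof. by move=> /param_rho h; rewrite /log_rad /Yr h. Qed.

(** [log_rad] takes the same value in all charts around a point, so the estimates on single pieces
    add up when a path changes charts. *)
Lemma pw_path_ge p q L : pw_path g p q L -> forall (i j : chart M) x y,
  param M i x = p -> param M j y = q -> (`|log_rad x - log_rad y|%:E <= L)%E.
Proof.
elim=> {p q L} [p|i0 c q L hc _ IH] i j x y xp yq.
  by rewrite (@param_log_rad i j x y) ?xp ?yq// subrr normr0.
rewrite (param_log_rad xp).
apply: (@le_trans _ _
  (`|log_rad (c 1) - log_rad (c 0)|%:E + `|log_rad (c 1) - log_rad y|%:E)%E); last first.
  by apply: leeD; [exact: curve_length_ge|exact: IH (erefl _) yq].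
rewrite -EFinD lee_fin -[X in _ <= X + _]normrN opprB.
rewrite (_ : log_rad (c 0) - log_rad y =
    (log_rad (c 0) - log_rad (c 1)) + (log_rad (c 1) - log_rad y)); last by ring.
exact: ler_normD.
Qed.

Lemma pw_path_cat p q r L L' : pw_path g p q L -> pw_path g q r L' ->
  pw_path g p r (L + L')%E.
Proof.
move=> h h'; elim: h h' => {p q L} [p|i c q L hc _ IH] h'; first by rewrite add0e.
by rewrite -addeA; apply: pw_path_cons => //; exact: IH.
Qed.

End OminusLengths.

(** * Compact sublevel sets, completeness and noncompactness *)

Section OminusCompleteness.
Variables (R : realType) (m : nat).
Local Notation C := (R[i]).
Local Notation K := (R[i] : numFieldType).
Local Notation V := ('rV[C]_2).
Local Notation VN := ('rV[R[i]]_2 : normedModType R[i]).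
Local Notation Yr := (@Yr R m).
Local Notation uc := (@uc R).
Local Notation zc := (@zc R).
Local Notation gmx := (@gmx R m).
Local Notation rho := (@rho R m).
Local Notation log_rad := (@log_rad R m).
Local Notation M := (Ominus R[i] m.+1).
Local Notation g := (@ominus_metric R m).
Implicit Types (u v w x y : V).

Lemma ball_rowP (x y : V) (e : C) :
  ball (x : VN) e (y : VN) <-> 0 < e /\ forall j, `|x 0 j - y 0 j| < e.
Proof.
split=> [[e0 h]|[e0 h]]; split=> //; first by move=> j; exact: h.
by move=> i j; rewrite !ord1; exact: h.
Qed.

Lemma gmx_near_bound (x : V) : exists2 B : C, 1 <= B &
  nbhs (x : VN) [set y | forall a b, `|gmx y a b| <= B].
Proof.
exists (1 + \sum_a \sum_b `|gmx x a b|).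
  by rewrite lerDl; apply: sumr_ge0 => a _; apply: sumr_ge0.
set B := 1 + _.
have h (ab : 'I_2 * 'I_2) : nbhs (x : VN) [set y | `|gmx y ab.1 ab.2| <= B].
  have gB : 0 < B - `|gmx x ab.1 ab.2|.
    rewrite subr_gt0 /B ltr_pwDl//.
    rewrite (bigD1 ab.1)//= (bigD1 ab.2)//= -addrA lerDl addr_ge0//.
      exact: sumr_ge0.
    by apply: sumr_ge0 => a _; apply: sumr_ge0.
  have hb : nbhs (gmx x ab.1 ab.2 : K)
      [set t : C | `|gmx x ab.1 ab.2 - t| < B - `|gmx x ab.1 ab.2|].
    by apply/nbhs_normP; exists (B - `|gmx x ab.1 ab.2|).
  have gc := smooth_continuous (@smooth_gmx R m ab.1 ab.2).
  apply: (@filterS _ (nbhs (x : VN)) _ _ _ _ (gc x _ hb)) => y /= hy.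
  rewrite -(subrK (gmx x ab.1 ab.2) (gmx y ab.1 ab.2)) (le_trans (ler_normD _ _))//.
  by rewrite -lerBrDr distrC ltW.
have hI : nbhs (x : VN) [set y | forall ab : 'I_2 * 'I_2, `|gmx y ab.1 ab.2| <= B].
  exact: (@filter_forall _ _ (fun ab y => `|gmx y ab.1 ab.2| <= B) (nbhs (x : VN)) _ h).
by apply: (@filterS _ (nbhs (x : VN)) _ _ _ _ hI) => y hy a b; exact: (hy (a, b)).
Qed.

Lemma line_C1 (y w : V) : C1_curve (fun s : R => y + s%:C%C *: w).
Proof.
move=> j; have h t := @ccurve_line R 2 y w t j.
have E1 : derive1 (fun s : R => Re ((y + s%:C%C *: w) 0 j)) = cst (Re (w 0 j)).
  by apply/funext => t; have [[_ h1] _] := h t; rewrite derive1E h1.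
have E2 : derive1 (fun s : R => Im ((y + s%:C%C *: w) 0 j)) = cst (Im (w 0 j)).
  by apply/funext => t; have [_ [_ h1]] := h t; rewrite derive1E h1.
split.
- by move=> t; have [[]] := h t.
- by move=> t; have [_ []] := h t.
- by rewrite E1; exact: cst_continuous.
- by rewrite E2; exact: cst_continuous.
Qed.

Lemma line_velocity (y w : V) t : velocity (fun s : R => y + s%:C%C *: w) t = w.
Proof.
apply/rowP => j; rewrite /velocity mxE.
have [[_ h1] [_ h2]] := @ccurve_line R 2 y w t j.
by rewrite !derive1E h1 h2; case: (w 0 j).
Qed.

Lemma hform_le (A : 'M[C]_2) (w : V) (B e : C) : 0 <= B ->
  (forall a b, `|A a b| <= B) -> (forall a, `|w 0 a| <= e) ->
  `|hform A w w| <= 4 * B * e ^+ 2.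
Proof.
move=> B0 hA hw; have e0 : 0 <= e := le_trans (normr_ge0 _) (hw 0).
have -> : 4 * B * e ^+ 2 = \sum_(a < 2) \sum_(b < 2) B * e * e.
  by rewrite !sumr_const card_ord -mulrnA -mulr_natl; ring.
apply: le_trans (ler_norm_sum _ _ _) _; apply: ler_sum => a _.
apply: le_trans (ler_norm_sum _ _ _) _; apply: ler_sum => b _.
by rewrite !normrM normcJ; apply: ler_pM => //; exact: ler_pM.
Qed.

(** Convergence in the manifold topology implies convergence for [riem_dist], tested on straight
    segments in a chart; these stay in a ball where the metric is bounded. *)
Lemma riem_dist_near (p : M) (e : R) : 0 < e ->
  exists2 U : set M, nbhs p U & forall q, U q -> (riem_dist g q p < e%:E)%E.
Proof.
move=> e0; have [i [x xp]] := param_cover p.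
have [B B1 hB] := gmx_near_bound x; have B0 : 0 < B := lt_le_trans ltr01 B1.
have eC : 0 < e%:C%C by rewrite ltcR.
(* Chosen so that the squared speed is at most 4 B eta^2 = (e / 2)^2 / B, hence at most (e / 2)^2 as
   B >= 1. *)
pose eta : C := e%:C%C / (4 * B).
have eta0 : 0 < eta by rewrite divr_gt0// mulr_gt0.
have [d d0 hd] : exists2 d : C, 0 < d & forall y, ball (x : VN) d (y : VN) ->
    (forall a b, `|gmx y a b| <= B) /\ (forall j, `|x 0 j - y 0 j| < eta).
  have hI : nbhs (x : VN) ([set y | forall a b, `|gmx y a b| <= B] `&`
      [set y : VN | ball (x : VN) eta y]).
    by apply: filterI => //; exact: nbhsx_ballx.
  have /nbhs_ballP[d d0 hd] := hI; exists d => // y /hd[h1 /ball_rowP[_ h2]]; split => //.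
exists (param M i @` [set y : V | ball (x : VN) d (y : VN)]).
  apply: open_nbhs_nbhs; split; last by exists x => //; exact: ballxx.
  apply: param_open; exact: ball_open.
move=> q [y /= xy yq].
pose w : V := x - y; pose c := fun s : R => y + s%:C%C *: w.
have c1 : c 1 = x by rewrite /c rmorph1 scale1r addrC subrK.
have c0 : c 0 = y by rewrite /c rmorph0 scale0r addr0.
have hp : pw_path g q p (curve_length g i c + 0)%E.
  have h0 : pw_path g (param M i (c 1)) p 0%E by rewrite c1 xp; exact: pw_path_nil.
  by rewrite -yq -{1}c0; apply: pw_path_cons h0; exact: line_C1.
apply: le_lt_trans (ereal_inf_lbound hp) _; rewrite adde0.
apply: (@le_lt_trans _ _ (e / 2)%:E); last first.
  by rewrite lte_fin ltr_pdivrMr// ltr_pMr// ltr1n.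
apply: integral_unit_le.
- by apply: speed_continuous (line_C1 y w) => a b; exact: smooth_gmx.
- by move=> t; exact: sqrtr_ge0.
move=> t /andP[t0 t1]; rewrite line_velocity.
have [_ xyd] := (ball_rowP _ _ _).1 xy.
have hc : ball (x : VN) d (c t : VN).
  apply/ball_rowP; split=> // j; apply: le_lt_trans (xyd j).
  have -> : x 0 j - c t 0 j = (1 - t)%:C%C * (x 0 j - y 0 j).
    by rewrite /c /w !mxE rmorphB rmorph1; ring.
  rewrite normrM ler_piMl// normc_def/= expr0n addr0 sqrtr_sqr lecR.
  by rewrite ger0_norm ?subr_ge0// gerBl.
have [hG _] := hd _ hc; have [_ hw] := hd _ xy.
have h1 : `|hform (gmx (c t)) w w| <= 4 * B * eta ^+ 2.
  by apply: hform_le => //; [exact: ltW|move=> a; rewrite /w !mxE; exact: ltW].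
have h2 : 4 * B * eta ^+ 2 <= ((e / 2) ^+ 2)%:C%C.
  have -> : 4 * B * eta ^+ 2 = (e%:C%C / 2) ^+ 2 / B.
    by rewrite /eta; field; rewrite gt_eqF.
  have -> : ((e / 2) ^+ 2)%:C%C = (e%:C%C / 2) ^+ 2.
    by rewrite rmorphXn fmorph_div rmorph_nat.
  by rewrite ler_piMr ?invf_le1// exprn_ge0// divr_ge0// ltW.
have -> : e / 2 = Num.sqrt ((e / 2) ^+ 2) by rewrite sqrtr_sqr ger0_norm// divr_ge0// ltW.
apply: ler_wsqrtr.
have G0 : 0 <= hform (gmx (c t)) w w by rewrite hform_gmx gform_ge0.
have := le_trans h1 h2; rewrite (ger0_norm G0) lecE => /andP[_].
exact.
Qed.

Lemma box_compact (b : R) :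
  compact ([set z : K | `|Re z| <= b /\ `|Im z| <= b] : set K).
Proof.
pose f (ab : R * R) : K := ab.1%:C%C + 'i%C * ab.2%:C%C.
have -> : [set z : K | `|Re z| <= b /\ `|Im z| <= b] =
    f @` (`[- b, b]%classic `*` `[- b, b]%classic).
  apply/seteqP; split=> [z [h1 h2]|z [[r s] [/= h1 h2] <-]].
    exists (Re z, Im z); last by rewrite /f /= -complexE.
    by split; rewrite /= in_itv/= -ler_norml.
  rewrite !in_itv/= -!ler_norml in h1 h2.
  have -> : f (r, s) = (r +i* s)%C by rewrite /f/=; apply: complex_eq; rewrite /=; ring.
  by [].
apply: continuous_compact; last by apply: compact_setX; exact: segment_compact.
apply: continuous_subspaceT => ab; apply: (@continuous_add K (R * R)%type) ab.
  by move=> ab; exact: (continuous_comp (@cvg_fst _ _ _ _ _)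
    (@real_complex_continuous R ab.1)).
apply: (@continuous_mul K (R * R)%type); first exact: cst_continuous.
by move=> ab; exact: (continuous_comp (@cvg_snd _ _ _ _ _)
    (@real_complex_continuous R ab.2)).
Qed.

Definition chart_box (b : R) : set V :=
  [set v | forall j, `|Re (v 0 j)| <= b /\ `|Im (v 0 j)| <= b].

Lemma chart_box_compact b : compact (chart_box b : set VN).
Proof.
have := @rV_compact K 2 (fun=> [set z : K | `|Re z| <= b /\ `|Im z| <= b])
  (fun=> @box_compact b).
exact.
Qed.

Definition atlas_box (b : R) : set M :=
  \bigcup_(i in [set: 'I_2]) param M i @` chart_box b.

Lemma atlas_box_compact b : compact (atlas_box b).
Proof.
have -> : atlas_box b =
    (param M 0 @` chart_box b) `|` (param M 1 @` chart_box b).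
  apply/seteqP; split=> [p [i _]|p [|]].
  - have [->|i0] := eqVneq i 0; first by left.
    have -> : i = 1 by case: i i0 => -[|[|//]] // ? ?; exact: val_inj.
    by right.
  - by exists 0.
  - by exists 1.
have h i : compact (param M i @` chart_box b : set M).
  apply: (@continuous_compact VN M (param M i) (chart_box b)).
    by apply: continuous_subspaceT; exact: param_continuous.
  exact: chart_box_compact.
exact: compactU.
Qed.

(** Either |z| <= 1 or |1 / z| <= 1, so the closed unit discs of the two charts cover the projective
    line. A bound on the base coordinate is thus free, and only u has to be controlled. *)
Lemma unit_disc_chart (p : M) : exists i x,
  param M i x = p /\ Re (zc x) ^+ 2 + Im (zc x) ^+ 2 <= 1.
Proof.
have [i [x xp]] := param_cover p.
have [h|h] := leP (Re (zc x) ^+ 2 + Im (zc x) ^+ 2) 1; first by exists i, x.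
have x0 : zc x != 0.
  by apply: contraTneq h => ->; rewrite /= expr0n addr0 -leNgt ler01.
have [j ji] : exists j : 'I_2, i != j.
  by case: (i) => -[|[|//]] ?; [exists 1|exists 0].
exists j, (Ominus_chart_change m.+1 x); split.
  by rewrite -xp; apply/esym/(@Ominus_chart_changeP R[i] m.+1 _ _ _ _ ji).
rewrite /zc mxE/= -/(zc x).
have h0 : 0 < Re (zc x) ^+ 2 + Im (zc x) ^+ 2 := lt_trans ltr01 h.
move: h h0; case: (zc x) => a b /= h h0; rewrite sqrrN !expr_div_n -mulrDl.
by rewrite ler_pdivrMr ?exprn_gt0// mul1r expr2 ler_peMl// ltW.
Qed.

(** From 1 + Y <= exp (2 E) follows |u|^2 <= [rho] = Y (1 + Y)^k <= exp (2 E)^(k + 1), where k + 1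
    is [m.+2]. The summand 1 covers |z| <= 1 and the passage from squares by |a| <= 1 + a^2. *)
Lemma bounded_log_rad_atlas_box (E : R) (p : M) (j : chart M) (y : V) :
  param M j y = p -> log_rad y <= E ->
  atlas_box (1 + expR (2 * E) ^+ m.+2) p.
Proof.
move=> yp yE; have [i [x [xp zx]]] := unit_disc_chart p.
have xE : log_rad x <= E by rewrite (@param_log_rad _ _ i j x y) ?xp ?yp.
exists i => //; exists x => //.
have Y0 := Yr_ge0 m x; have Y1 : 0 < 1 + Yr x by rewrite ltr_wpDr.
have e0 : 0 < expR (2 * E) by exact: expR_gt0.
have YE : 1 + Yr x <= expR (2 * E).
  rewrite -[leLHS]lnK; last by rewrite posrE.
  by rewrite ler_expR; move: xE; rewrite /log_rad mulrC ler_pdivrMr// mulrC.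
have rE : Re (rho x) <= expR (2 * E) ^+ m.+2.
  have [_ <-] := momentP m (Re_rho_ge0 m x); rewrite /rho_of_moment -/(Yr x) [leRHS]exprS.
  have X0 : 0 <= (1 + Yr x) ^+ m.+1 by rewrite exprn_ge0// ltW.
  apply: ler_pM => //; first by apply: le_trans YE; rewrite lerDr.
  by apply: lerXn2r => //; rewrite nnegrE ltW.
have uE : Re (uc x) ^+ 2 + Im (uc x) ^+ 2 <= expR (2 * E) ^+ m.+2.
  apply: le_trans rE.
  have h : uc x * (uc x)^*%C <= rho x.
    rewrite /rho ler_peMr ?mulcJ_ge0// exprn_ege1// /bnorm lerDl mulcJ_ge0 //.
  move: h; rewrite lecE => /andP[_]; rewrite Re_mul Re_conjc Im_conjc mulrN opprK -!expr2.
  exact.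
have ab (a b c : R) : a ^+ 2 + b ^+ 2 <= c -> `|a| <= 1 + c.
  move=> h; have := sqr_ge0 b; have : a ^+ 2 = `|a| ^+ 2 by rewrite real_normK ?num_real.
  by move: h; move: `|a| => n; move: (a ^+ 2) => s; move: (b ^+ 2) => t; nra.
have e2 : 0 <= expR (2 * E) ^+ m.+2 by rewrite exprn_ge0// ltW.
have n1 (a b : R) : a ^+ 2 + b ^+ 2 <= 1 -> `|a| <= 1.
  move=> h; rewrite -(@expr_le1 _ 2)// real_normK ?num_real//.
  by apply: le_trans h; rewrite lerDl sqr_ge0.
move=> j'; have [->|j0] := eqVneq j' 0.
  have zle t : t <= 1 -> t <= 1 + expR (2 * E) ^+ m.+2.
    by move=> h; rewrite -[leLHS]addr0 lerD.
  by split; apply: zle; [exact: n1 zx|apply: (n1 _ (Re (zc x))); rewrite addrC].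
have -> : j' = 1 by case: j' j0 => -[|[|//]] // ? ?; exact: val_inj.
by split; [exact: ab uE|apply: (ab _ (Re (uc x))); rewrite addrC].
Qed.

Lemma riem_dist_triangle_lt (p q r : M) (d e : R) :
  (riem_dist g p q < d%:E)%E -> (riem_dist g q r < e%:E)%E ->
  (riem_dist g p r < (d + e)%:E)%E.
Proof.
move=> /ereal_inf_lt[L1 h1 l1] /ereal_inf_lt[L2 h2 l2].
apply: le_lt_trans (ereal_inf_lbound (pw_path_cat h1 h2)) _.
by rewrite EFinD lteD.
Qed.

(** A tail of a Cauchy sequence stays within distance 1 of one of its terms, so [log_rad] is bounded
    on it and the tail lies in a compact box. A cluster point of a Cauchy sequence is its limit. *)
Lemma ominus_complete : complete_metric g.
Proof.
move=> u hu; have [N0 h0] := hu 1 ltr01.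
have [i0 [x0 xp0]] := param_cover (u N0).
pose b := 1 + expR (2 * (log_rad x0 + 1)) ^+ m.+2.
have uK l : (N0 <= l)%N -> atlas_box b (u l).
  move=> Nl; have [j [y yp]] := param_cover (u l).
  apply: (bounded_log_rad_atlas_box yp).
  have /ereal_inf_lt[L hL L1] := h0 N0 l (leqnn _) Nl.
  have := le_lt_trans (pw_path_ge hL xp0 yp) L1; rewrite lte_fin => /ltW.
  by rewrite ler_distlC => /andP[].
have FK : (u @ \oo) (atlas_box b).
  by exists N0 => // l /= Nl; exact: uK.
have [p [_ hp]] := @atlas_box_compact _ (u @ \oo) _ FK.
exists p => e e0; have e20 : 0 < e / 2 by rewrite divr_gt0.
have [N hN] := hu _ e20; exists N => l Nl.
have [U pU hU] := riem_dist_near p e20.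
have [q [[l' Nl' <-] qU]] : [set u l' | l' in [set l' | (N <= l')%N]] `&` U !=set0.
  by apply: hp => //; exists N => // k /= Nk; exists k.
rewrite [e]splitr; apply: riem_dist_triangle_lt (hU _ qU); exact: hN.
Qed.

(** The points u = n of one fibre have [rho] = n^2, while near a cluster point the continuous
    function [rho] would stay bounded. *)
Lemma ominus_noncompact : ~ compact [set: M].
Proof.
pose pt (n : nat) : V := \row_j (if j == 0 then 0 else n%:R).
have rpt n : Re (rho (pt n)) = n%:R ^+ 2.
  have -> : rho (pt n) = (n%:R ^+ 2)%:C%C.
    rewrite /rho /bnorm /zc /uc !mxE/= mul0r addr0 expr1n mulr1 conjc_nat -expr2.
    by rewrite rmorphXn rmorph_nat.
  by [].
move=> cM; have [p [_ hp]] := cM ((fun n => param M 0 (pt n)) @ \oo) _ filterT.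
have [i [x xp]] := param_cover p.
pose W : set V := [set y | Re (rho y) < Re (rho x) + 1].
have oW : open (W : set VN).
  have rc := smooth_Re_continuous (@smooth_rho R m).
  have o := @open_lt R (Re (rho x) + 1).
  exact: (@open_comp VN R (fun y => Re (rho y)) _ (fun y _ => rc y) o).
have pW : nbhs p (param M i @` W).
  apply: open_nbhs_nbhs; split; first exact: param_open.
  by exists x => //; rewrite /W /= ltrDl.
pose N := Num.bound (Re (rho x) + 1).
have [_ [[n /= Nn <-] [y Wy /param_rho yn]]] :
    [set param M 0 (pt n) | n in [set n | (N <= n)%N]] `&` (param M i @` W) !=set0.
  by apply: hp => //; exists N => // n /= Nn; exists n.
move: Wy; rewrite /W/= yn rpt; apply/negP; rewrite -leNgt.
have b0 : 0 <= Re (rho x) + 1 by rewrite addr_ge0// Re_rho_ge0.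
apply: le_trans (ltW (archi_boundP b0)) _; rewrite -/N.
apply: (@le_trans _ _ n%:R); first by rewrite ler_nat.
by rewrite -natrX ler_nat; case: (n) => // k; rewrite expnS leq_pmulr// expn_gt0.
Qed.

End OminusCompleteness.

Theorem theorem1p5 (R : realType) (k : nat) (hk : (0 < k)%N) :
  ~ compact [set: Ominus R[i] k] /\
  exists g : hermitian_metric (Ominus R[i] k),
    [/\ kahler g, complete_metric g, semipositive_hsc g & rank_plus g = 1%N].
Proof.
case: k hk => // m _; split; first exact: ominus_noncompact.
exists (ominus_metric R m); split.
- exact: ominus_kahler.
- exact: ominus_complete.
- exact: ominus_semipositive.
- exact: ominus_rank.
Qed.
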